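(* For every integer $n\geq 4$, the number of Dyck paths of semilength $n$ with $L=4$ is $$|\mathcal{D}_n^4| = 2\left(T_{n-2,3}+\sum_{i=0}^{n-6}(i+1)M_i\,T_{n-4-i,3}\right)+\binom{n-5}{2}M_{n-7}+M_{n-5}+2\sum_{i=0}^{n-7}(i+1)M_iM_{n-7-i},$$ where $M_j=0$ for $j<0$ (so the term $\binom{n-5}{2}M_{n-7}$ is $0$ for $n<7$). Also, $|\mathcal{D}_3^4|=1$.
   Context: A Dyck path of semilength $n$ is a path from $(0,0)$ to $(2n,0)$ with up steps $u=(1,1)$ and down steps $d=(1,-1)$ that does not pass below the $x$-axis; $\mathcal{D}_n$ is the set of these. For $D\in\mathcal{D}_n$ and $1\le i\le n-1$, $r_i(D)$ is the number of down steps between the $i$th and $(i+1)$st up steps of $D$, and $s_i(D)$ is the number of up steps between the $i$th and $(i+1)$st down steps of $D$. The statistic $L$ is $L(D)=\prod_{i=1}^{n-1}\binom{r_i(D)+s_i(D)}{r_i(D)}$ (empty product $=1$). $\mathcal{D}_n^k=\{D\in\mathcal{D}_n : L(D)=k\}$. A Motzkin path of length $n$ is a path from $(0,0)$ to $(n,0)$ with steps $u=(1,1)$, $d=(1,-1)$, $h=(1,0)$ that does not pass below the $x$-axis; for $n\ge 0$, $M_n$ is the number of Motzkin paths of length $n$. The Motzkin ballot numbers $T_{n,k}$ ($k\ge 1$, $n\ge k-1$) are defined as follows: for $n\ge k$, $T_{n,k}$ is the number of Motzkin paths of length $n$ whose first down step is the $k$th step; and $T_{k-1,k}=1$ (counting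 the single Motzkin path consisting of $k-1$ horizontal steps). A sum whose upper limit is less than its lower limit is empty and equals $0$. *)

(* Defs.v *)
From HB Require Import structures.
From mathcomp Require Import all_boot all_order all_algebra.

Set Implicit Arguments.
Unset Strict Implicit.
Unset Printing Implicit Defensive.

(* (1,1), (1,-1) and (1,0) respectively *)
Inductive step := Up | Down | Flat.

Definition ord_of_step (x : step) : 'I_3 :=
  match x with
  | Up => @Ordinal 3 0 isT
  | Down => @Ordinal 3 1 isT
  | Flat => @Ordinal 3 2 isT
  end.

Definition step_of_ord (i : 'I_3) : step :=
  match val i with 0 => Up | 1 => Down | _ => Flat end.

Lemma ord_of_stepK : cancel ord_of_step step_of_ord.
Proof. by case. Qed.

HB.instance Definition _ := Finite.copy step (can_type ord_of_stepK).

(* Ordinate of the endpoint of a path starting at the origin. *)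
Definition height (p : seq step) : int :=
  ((count_mem Up p)%:Z - (count_mem Down p)%:Z)%R.

Definition motzkin_path (p : seq step) : bool :=
  (height p == 0%R) &&
  all (fun k => (0 <= height (take k p))%R) (iota 0 (size p).+1).

Definition dyck_path (p : seq step) : bool :=
  motzkin_path p && (Flat \notin p).

(* Position in p (from 0) of the i-th (from 1) occurrence of x. *)
Definition pos (x : step) (p : seq step) (i : nat) : nat :=
  nth 0 [seq j <- iota 0 (size p) | nth Flat p j == x] i.-1.

(* The steps strictly between the i-th and (i+1)-st occurrences of x. *)
Definition between (x : step) (p : seq step) (i : nat) : seq step :=
  drop (pos x p i).+1 (take (pos x p i.+1) p).

Definition rstat (p : seq step) (i : nat) : nat := count_mem Down (between Up p i).

Definition sstat (p : seq step) (i : nat) : nat := count_mem Up (between Down p i).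

Definition Lstat (n : nat) (p : seq step) : nat :=
  \prod_(1 <= i < n) 'C(rstat p i + sstat p i, rstat p i).

Definition dyckL (n k : nat) : {set n.*2.-tuple step} :=
  [set p : n.*2.-tuple step | dyck_path p && (Lstat n p == k)].

Definition motzkin (j : int) : nat :=
  match j with
  | Posz m => #|[set p : m.-tuple step | motzkin_path p]|
  | Negz _ => 0
  end.

(* Motzkin ballot numbers T_{n,k}, meaningful for 1 <= k <= n + 1. For k <= n
   the condition (index Down p).+1 = k forces index Down p < n, so that p does
   have a down step and the first one is the k-th step. *)
Definition ballot (n k : nat) : nat :=
  if n.+1 == k then 1
  else #|[set p : n.-tuple step
            | motzkin_path p && ((index Down p).+1 == k)]|.

(* Main.v *)
(** Let [n] be the semilength, and for [1 <= i < n] record whether [r_i > 0] (the [i]-th up step is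
    followed by a down step) and whether [s_i > 0].  These [n - 1] pairs of bits, read as down step,
    up step, flat step, or double step (both bits set), form a two-coloured Motzkin path which
    determines the Dyck path.  Only double steps contribute to [L].  If a double step at height [h]
    has prefix [u] and suffix [w], then [r_i] is the distance between the [h]-th and [(h+1)]-st up
    steps of [u] counted backwards, and [s_i] that between the [h]-th and [(h+1)]-st down steps of
    [w].  Hence [L = 4] iff there is one double step with [{r, s} = {1, 3}], or there are two, each
    with [r = s = 1].

    With [M] the generating function of Motzkin paths, [W = z M], [M = 1 + W + W^2] and
    [E = 1 / (1 - W^2)], reading a path step by step shows that paths from height [h] to [0] whose
    [h]-th gap is [s + 1] have generating function [(z (1 + W))^s W^h]: a remaining path contributes
    the same amount wherever the reader stands relative to the [h]-th down step.  Similar closed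
    forms hold for the middle part between two double steps, and summing over the heights gives
    [2 z^3 (1 + W)^2 E + z^2 + z^3 W (E^2 + E - 1 + W^4 E^3)] for the paths of length [n - 1].
    Since [(i + 1) M_i] and [C(i + 2, 2) M_i] have generating functions [M^2 E] and [M^3 E^3], this
    is the stated formula; the isolated term [z^2] is the path counted for [n = 3].

    Series are handled modulo [z^K], that is, in a commutative ring where [z^K = 0]. *)

Require Import Defs.
From mathcomp Require Import all_boot all_order all_algebra.
From mathcomp Require Import qpoly ring zify.

Set Implicit Arguments.
Unset Strict Implicit.
Unset Printing Implicit Defensive.

Import GRing.Theory.

(** * Generating functions of languages *)

Section WordSeries.
Local Open Scope ring_scope.
Context (A : comNzRingType) (z : A) (K : nat).

Definition wsum (T : finType) (l : nat) (F : seq T -> A) : A :=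
  \sum_(t : l.-tuple T) F t.

Definition gf (T : finType) (F : seq T -> A) : A :=
  \sum_(l < K) z ^+ l * wsum l F.

Lemma wsum0 (T : finType) (F : seq T -> A) : wsum 0 F = F [::].
Proof.
rewrite /wsum (big_pred1 [tuple]) // => t.
by apply/esym/eqP; exact: tuple0.
Qed.

Lemma wsumS (T : finType) l (F : seq T -> A) :
  wsum l.+1 F = \sum_(x : T) wsum l (fun w => F (x :: w)).
Proof.
rewrite /wsum pair_bigA /=.
rewrite (reindex (fun p : T * l.-tuple T => [tuple of p.1 :: p.2])) //=.
exists (fun t : l.+1.-tuple T => (thead t, [tuple of behead t])).
  by move=> [x t] _; congr (_, _); apply: val_inj.
by move=> t _; rewrite -tuple_eta.
Qed.

Lemma eq_gf (T : finType) (F G : seq T -> A) :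
  (forall w, (size w < K)%N -> F w = G w) -> gf F = gf G.
Proof.
move=> eqFG; apply: eq_bigr => l _; congr (_ * _); apply: eq_bigr => t _.
by apply: eqFG; rewrite size_tuple.
Qed.

Lemma gfZ (T : finType) c (F : seq T -> A) : gf (fun w => c * F w) = c * gf F.
Proof.
rewrite /gf mulr_sumr; apply: eq_bigr => l _.
by rewrite /wsum -mulr_sumr mulrCA.
Qed.

Lemma gfD (T : finType) (F G : seq T -> A) :
  gf (fun w => F w + G w) = gf F + gf G.
Proof.
by rewrite /gf -big_split; apply: eq_bigr => l _; rewrite /wsum big_split mulrDr.
Qed.

Lemma gf_sum (T : finType) (I : Type) (r : seq I) (F : I -> seq T -> A) :
  gf (fun w => \sum_(i <- r) F i w) = \sum_(i <- r) gf (F i).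
Proof.
elim: r => [|i r IHr].
  rewrite big_nil /gf big1 // => l _; rewrite /wsum big1 ?mulr0 // => t _.
  by rewrite big_nil.
by rewrite big_cons -IHr -gfD; apply: eq_gf => w _; rewrite big_cons.
Qed.

Lemma gf0 (T : finType) : gf (fun _ : seq T => 0) = 0.
Proof.
by rewrite /gf big1 // => l _; rewrite /wsum big1 ?mulr0.
Qed.

Lemma gf_eq0 (T : finType) (F : seq T -> A) : (forall w, F w = 0) -> gf F = 0.
Proof. by move=> F0; rewrite -[RHS](gf0 T); exact: eq_gf. Qed.

Lemma gf_exchange (T U : finType) (F : seq T -> seq U -> A) :
  gf (fun v => gf (fun w => F v w)) = gf (fun w => gf (fun v => F v w)).
Proof.
rewrite /gf /wsum.
under eq_bigr => i _ do rewrite exchange_big mulr_sumr /=.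
rewrite exchange_big /=; apply: eq_bigr => j _.
rewrite exchange_big /= mulr_sumr; apply: eq_bigr => i _.
rewrite -mulr_sumr mulrCA; congr (_ * _).
by rewrite -mulr_sumr exchange_big.
Qed.

Lemma gf_map_rev (T : finType) (s : T -> T) (F : seq T -> A) :
  involutive s -> gf (fun w => F (rev (map s w))) = gf F.
Proof.
move=> sK; apply: eq_bigr => l _; congr (_ * _); rewrite /wsum.
rewrite [RHS](reindex_inj (h := fun t : l.-tuple T => [tuple of rev [tuple of map s t]])) //.
move=> t u /(congr1 val) /= /(can_inj revK) /(inj_map (inv_inj sK)).
exact: val_inj.
Qed.

Context (zK : z ^+ K = 0).

(** On the right, the words of length [K - 1] behind the first letter carry the factor [z ^+ K],
    which is zero, so both sides are cut off at the same length. *)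
Lemma gf_cons (T : finType) (F : seq T -> A) :
  gf F = F [::] + z * \sum_x gf (fun w => F (x :: w)).
Proof.
rewrite /gf; case: K zK => [|k zk].
  by rewrite expr0 => /eqP; rewrite oner_eq0.
rewrite big_ord_recl expr0 mul1r wsum0; congr (_ + _).
rewrite exchange_big big_ord_recr /= -mulr_sumr mulrDr mulrA -exprS zk mul0r.
rewrite addr0 mulr_sumr; apply: eq_bigr => l _.
by rewrite -mulr_sumr mulrA -exprS wsumS.
Qed.

(* [v] is the value of [gf f] granted that [gf (F s) = G s] for all [s] in [I]. *)
Definition reduces (T : finType) (S : Type) (I : S -> Prop)
    (F : S -> seq T -> A) (G : S -> A) (f : seq T -> A) (v : A) : Prop :=
  exists e c s, [/\ c = 0 \/ I s, gf f = e + c * gf (F s) & v = e + c * G s].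

(* [gf (F s)] and [G s] satisfy the same recurrence, in which the unknowns have a factor [z], and [z]
   is nilpotent. *)
Lemma gf_solve (T : finType) (S : Type) (I : S -> Prop)
    (F : S -> seq T -> A) (G : S -> A) :
  (forall s, I s -> exists2 v : T -> A,
     forall x, reduces I F G (fun w => F s (x :: w)) (v x)
     & G s = F s [::] + z * \sum_x v x) ->
  forall s, I s -> gf (F s) = G s.
Proof.
(* The recurrence provides one factor [z]: if [z ^+ (K - j)] kills all differences, then so does the
   next lower power, down to exponent 0. *)
move=> rec; suff zP j s : I s -> (j <= K)%N -> z ^+ (K - j) * (gf (F s) - G s) = 0.
  move=> s Is; have := zP K s Is (leqnn K).
  by rewrite subnn expr0 mul1r => /eqP; rewrite subr_eq0 => /eqP.
elim: j s => [|j IHj] s Is lejK; first by rewrite subn0 zK mul0r.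
have [v Iv ->] := rec s Is.
rewrite gf_cons opprD addrACA subrr add0r -mulrBr mulrA -exprSr -subSn // subSS.
rewrite -sumrB mulr_sumr big1 // => x _.
have [e [c [s' [Is' -> ->]]]] := Iv x.
rewrite opprD addrACA subrr add0r -mulrBr mulrCA.
case: Is' => [-> | Is']; first by rewrite mul0r.
by rewrite IHj ?mulr0 // ltnW.
Qed.

Lemma reduces_state (T : finType) (S : Type) (I : S -> Prop)
    (F : S -> seq T -> A) (G : S -> A) f s :
  I s -> f =1 F s -> reduces I F G f (G s).
Proof.
move=> Is eqf; exists 0, 1, s; rewrite !add0r !mul1r; split=> //; first by right.
exact: eq_gf.
Qed.

(** The unknown gets coefficient 0, so [s] may be any state. *)
Lemma reduces_known (T : finType) (S : Type) (I : S -> Prop)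
    (F : S -> seq T -> A) (G : S -> A) (s : S) f v :
  gf f = v -> reduces I F G f v.
Proof. by exists v, 0, s; rewrite !mul0r !addr0; split=> //; left. Qed.

Lemma reduces_dead (T : finType) (S : Type) (I : S -> Prop)
    (F : S -> seq T -> A) (G : S -> A) (s : S) f :
  f =1 (fun=> 0) -> reduces I F G f 0.
Proof.
by move=> f0; apply: (reduces_known _ _ _ s); exact: gf_eq0.
Qed.

Lemma reduces_add_state (T : finType) (S : Type) (I : S -> Prop)
    (F : S -> seq T -> A) (G : S -> A) (s : S) g v f :
  gf g = v -> I s -> f =1 (fun w => g w + F s w) -> reduces I F G f (v + G s).
Proof.
move=> <- Is fE; exists (gf g), 1, s; rewrite !mul1r; split=> //; first by right.
by rewrite -gfD; exact: eq_gf.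
Qed.

End WordSeries.

Local Arguments reduces_state {A z K T S I F G f} s _ _.
Local Arguments reduces_known {A z K T S I F G} s {f v} _.
Local Arguments reduces_dead {A z K T S I F G} s {f} _.
Local Arguments reduces_add_state {A z K T S I F G} s {g v f} _ _ _.

(** * Languages of Motzkin paths *)

(* Distances between consecutive occurrences of [true] in [b], with two additional occurrences just
   before the first and just after the last position. *)
Fixpoint gaps (b : seq bool) : seq nat :=
  match b with
  | [::] => [:: 1]
  | true :: b' => 1 :: gaps b'
  | false :: b' => (head 0 (gaps b')).+1 :: behead (gaps b')
  end.

Definition gap (k : nat) (b : seq bool) : nat := nth 0 (gaps b) k.

Definition marks (x : step) (w : seq step) : seq bool := map (pred1 x) w.

Fixpoint run (h : nat) (w : seq step) : option nat :=
  match w with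
  | [::] => Some h
  | Up :: w' => run h.+1 w'
  | Down :: w' => if h is h'.+1 then run h' w' else None
  | Flat :: w' => run h w'
  end.

Definition mot (h : nat) (w : seq step) : bool := run h w == Some 0.

Lemma gap_cons k c b :
  gap k (c :: b) =
  if c then (if k is k'.+1 then gap k' b else 1) else (k == 0) + gap k b.
Proof.
rewrite /gap; case: c => /=; first by case: k.
by case: k => [|k] /=; [case: (gaps b) | rewrite nth_behead].
Qed.

Lemma big_step (V : nmodType) (F : step -> V) :
  (\sum_x F x = F Up + F Down + F Flat)%R.
Proof.
rewrite (bigD1 Up) //= (bigD1 Down) //= (bigD1 Flat) //= big1 ?addr0 ?addrA //.
by case.
Qed.

(** * Closed forms for paths read from a given height *)

Section ClosedForms.
Local Open Scope ring_scope.
Context (A : comNzRingType) (z : A) (K : nat) (zK : z ^+ K = 0).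
Context (W M E : A) (zM : z * M = W) (ME : M = 1 + W + W ^+ 2) (EE : E = 1 + W ^+ 2 * E).

Local Notation gf := (gf z K).

Definition ind (b : bool) : A := b%:R.

Lemma gf_solve_step (S : Type) (I : S -> Prop) (F : S -> seq step -> A) (G : S -> A) :
  (forall s, I s -> exists vU vD vF : A,
     [/\ reduces z K I F G (fun w => F s (Up :: w)) vU,
         reduces z K I F G (fun w => F s (Down :: w)) vD,
         reduces z K I F G (fun w => F s (Flat :: w)) vF
       & G s = F s [::] + z * (vU + vD + vF)]) ->
  forall s, I s -> gf (F s) = G s.
Proof.
move=> rec; apply: gf_solve => // s Is; have [vU [vD [vF [rU rD rF Gs]]]] := rec s Is.
exists (fun x => match x with Up => vU | Down => vD | Flat => vF end) => [[]|] //.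
by rewrite big_step.
Qed.

(** The first visits of the heights [h - 1], ..., 0 cut off [h] Motzkin paths, each followed by a
    down step and so contributing [z * M = W]; a Motzkin path remains. *)
Lemma gf_mot h : gf (fun w => ind (mot h w)) = W ^+ h * M.
Proof.
apply: (gf_solve_step (I := fun=> True)
  (F := fun h w => ind (mot h w)) (G := fun h => W ^+ h * M)) => // {}h _.
case: h => [|h].
  exists (W ^+ 1 * M), 0, (W ^+ 0 * M); split.
  - exact: (reduces_state 1%N).
  - exact: (reduces_dead 0%N).
  - exact: (reduces_state 0%N).
  - by rewrite /ind /=; ring: zM ME.
exists (W ^+ h.+2 * M), (W ^+ h * M), (W ^+ h.+1 * M); split;
  [exact: (reduces_state h.+2) | exact: (reduces_state h) | exact: (reduces_state h.+1) |].
rewrite /ind /= !exprS; ring: zM ME.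
Qed.

(* The cofactors [c1], [c2], [c3] witness that [a - b] is in the ideal of the relations between [z],
   [W], [M] and [E]. *)
Lemma eq_mod c1 c2 c3 a b :
  a = b + c1 * (z * M - W) + c2 * (M - (1 + W + W ^+ 2))
        + c3 * (E - (1 + W ^+ 2 * E)) -> a = b.
Proof. by move=> ->; rewrite zM -ME -EE !subrr !mulr0 !addr0. Qed.

Local Arguments eq_mod c1 c2 c3 {a b} _.

(** Formally the derivative of [z * W ^+ h * M = W ^+ h.+1], where [W] has derivative
    [M ^+ 2 * E]. *)
Lemma gf_mot_size h :
  gf (fun w => (size w).+1%:R * ind (mot h w)) = h.+1%:R * W ^+ h * M ^+ 2 * E.
Proof.
apply: (gf_solve_step (I := fun=> True)
  (F := fun h w => (size w).+1%:R * ind (mot h w))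
  (G := fun h => h.+1%:R * W ^+ h * M ^+ 2 * E)) => // {}h _.
have step h' w : (size w).+2%:R * ind (mot h' w) =
    ind (mot h' w) + (size w).+1%:R * ind (mot h' w).
  by rewrite -[_.+2%:R]natr1; ring.
case: h => [|h].
  exists (W ^+ 1 * M + 2%:R * W ^+ 1 * M ^+ 2 * E), 0,
    (W ^+ 0 * M + 1%:R * W ^+ 0 * M ^+ 2 * E); split.
  - by apply: (reduces_add_state 1%N (gf_mot 1)) => // w; exact: step.
  - by apply: (reduces_dead 0%N) => w; rewrite /ind /= mulr0.
  - by apply: (reduces_add_state 0%N (gf_mot 0)) => // w; exact: step.
  - rewrite /ind /=; apply: (eq_mod (- (W + 2 * W * M * E + 1 + M * E)) (1 + M * E) M).
    ring.
exists (W ^+ h.+2 * M + h.+3%:R * W ^+ h.+2 * M ^+ 2 * E),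
  (W ^+ h * M + h.+1%:R * W ^+ h * M ^+ 2 * E),
  (W ^+ h.+1 * M + h.+2%:R * W ^+ h.+1 * M ^+ 2 * E); split.
- by apply: (reduces_add_state h.+2 (gf_mot _)) => // w; exact: step.
- by apply: (reduces_add_state h (gf_mot _)) => // w; exact: step.
- by apply: (reduces_add_state h.+1 (gf_mot _)) => // w; exact: step.
rewrite /ind /= !exprS -!natr1; set P := W ^+ h; set H := h%:R.
apply: (eq_mod
  (- P * (1 + W + W ^+ 2 + M * E * ((H + 3) * W ^+ 2 + (H + 2) * W + (H + 1))))
  (P * W + (H + 2) * P * W * M * E) (P * W * M)).
ring.
Qed.

(** Formally half the second derivative of [z ^+ 2 * W ^+ h * M = z * W ^+ h.+1]. *)
Lemma gf_mot_bin2 h :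
  gf (fun w => 'C((size w).+2, 2)%:R * ind (mot h w)) =
  W ^+ h * M ^+ 3 * E ^+ 2 * ('C(h.+1, 2)%:R + h.+1%:R * E).
Proof.
pose g h := W ^+ h * M + h.+1%:R * W ^+ h * M ^+ 2 * E.
have gP h' : gf (fun w => (size w).+2%:R * ind (mot h' w)) = g h'.
  rewrite /g -gf_mot_size -gf_mot -gfD; apply: eq_gf => w _.
  by rewrite -[_.+2%:R]natr1; ring.
pose G h := W ^+ h * M ^+ 3 * E ^+ 2 * ('C(h.+1, 2)%:R + h.+1%:R * E).
apply: (gf_solve_step (I := fun=> True)
  (F := fun h w => 'C((size w).+2, 2)%:R * ind (mot h w)) (G := G)) => // {}h _.
(* Pascal's rule: reading a letter adds a linear weight, whose series [g] is known. *)
have step h' w : 'C((size w).+3, 2)%:R * ind (mot h' w) =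
    (size w).+2%:R * ind (mot h' w) + 'C((size w).+2, 2)%:R * ind (mot h' w).
  by rewrite binS bin1 natrD; ring.
case: h => [|h].
  exists (g 1%N + G 1%N), 0, (g 0%N + G 0%N); split.
  - by apply: (reduces_add_state 1%N (gP 1%N)) => // w; exact: step.
  - by apply: (reduces_dead 0%N) => w; rewrite /ind /= mulr0.
  - by apply: (reduces_add_state 0%N (gP 0%N)) => // w; exact: step.
  rewrite /ind /= /g /G /=.
  apply: (eq_mod
    (- (W * (1 + 2 * M * E + M ^+ 2 * E ^+ 2 * (1 + 2 * E))
        + (1 + M * E + M ^+ 2 * E ^+ 3)))
    (M ^+ 2 * E ^+ 3 + 1 + M * E) (M ^+ 2 * E ^+ 2 + M ^+ 2 * E + M)).
  rewrite binn bin_small //; ring.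
exists (g h.+2 + G h.+2), (g h + G h), (g h.+1 + G h.+1); split.
- by apply: (reduces_add_state h.+2 (gP _)) => // w; exact: step.
- by apply: (reduces_add_state h (gP _)) => // w; exact: step.
- by apply: (reduces_add_state h.+1 (gP _)) => // w; exact: step.
have -> : ind (mot h.+1 [::]) = 0 by [].
have T2 k : 'C(k.+1, 2)%:R = 'C(k, 2)%:R + k%:R :> A by rewrite binS bin1 natrD.
rewrite /G /g !T2 !exprS -!natr1; set P := W ^+ h; set H := h%:R; set T := 'C(h, 2)%:R + H.
pose Q := W ^+ 2 * (1 + (H + 3) * M * E
                    + M ^+ 2 * E ^+ 2 * (T + H + 1 + H + 2 + E * (H + 3)))
  + W * (1 + (H + 2) * M * E + M ^+ 2 * E ^+ 2 * (T + H + 1 + E * (H + 2)))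
  + (1 + (H + 1) * M * E + M ^+ 2 * E ^+ 2 * (T + E * (H + 1))).
apply: (eq_mod (- P * Q)
  (P * W * (M ^+ 2 * E ^+ 2 * (T + H + 1 + E * (H + 2)) + 1 + (H + 2) * M * E))
  (P * W * (M ^+ 2 * E ^+ 2 + (H + 2) * M ^+ 2 * E + M))).
by rewrite /Q /T; ring.
Qed.

Lemma gap0_gt0 b : (0 < gap 0 b)%N.
Proof. by case: b => [|[] b] //; rewrite gap_cons /= addnC addn1. Qed.

Lemma gap0_false b : (gap 0 (false :: b) == 1%N) = false.
Proof. by rewrite gap_cons eqSS eqn0Ngt gap0_gt0. Qed.

(** Before the gap begins, [k] plays no part in the recurrence [W ^+ h.+1 = z * (W ^+ h + W ^+ h.+1
    + W ^+ h.+2)]. Inside it, each of the [s] letters to be skipped is an up or a flat step, whence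
    the factors [z * (1 + W)]. *)
Lemma gf_mot_gap s k h : (k <= h)%N ->
  gf (fun w => ind (mot h w && (gap k (marks Down w) == s.+1)))
  = (z * (1 + W)) ^+ s * W ^+ h.
Proof.
suff sol p : (p.1.2 <= p.2)%N ->
    gf (fun w => ind (mot p.2 w && (gap p.1.2 (marks Down w) == p.1.1.+1)))
    = (z * (1 + W)) ^+ p.1.1 * W ^+ p.2 by exact: (sol (s, k, h)).
apply: (gf_solve_step (I := fun p => (p.1.2 <= p.2)%N)
  (F := fun p w => ind (mot p.2 w && (gap p.1.2 (marks Down w) == p.1.1.+1)))
  (G := fun p => (z * (1 + W)) ^+ p.1.1 * W ^+ p.2)) => {s k h p} [[[s k] h]] /=.
case: k => [|k] lekh.
  case: s => [|s].
    (* The gap closes at once: by a down step if the height is positive, by the end of the path at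
       height 0. *)
    exists 0, (if h is h'.+1 then W ^+ h' * M else 0), 0; split.
    - apply: (reduces_dead (0, 0, 0)%N) => w.
      by rewrite gap0_false andbF.
    - case: h {lekh} => [|h]; first exact: (reduces_dead (0, 0, 0)%N).
      apply: (reduces_known (0, 0, 0)%N); rewrite -gf_mot; apply: eq_gf => w _.
      by rewrite [marks _ _]/= gap_cons /= eqxx andbT.
    - apply: (reduces_dead (0, 0, 0)%N) => w.
      by rewrite gap0_false andbF.
    - case: h {lekh} => [|h]; rewrite /ind /=; first by ring.
      rewrite exprS; apply: (eq_mod (- W ^+ h) 0 0); ring.
  exists ((z * (1 + W)) ^+ s * W ^+ h.+1), 0, ((z * (1 + W)) ^+ s * W ^+ h); split.
  - exact: (reduces_state (s, 0, h.+1)%N).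
  - apply: (reduces_dead (0, 0, 0)%N) => w.
    by rewrite /= gap_cons /= andbF.
  - exact: (reduces_state (s, 0, h)%N).
  - by rewrite andbF /ind /= !exprS; ring.
case: h lekh => // h; rewrite ltnS => lekh.
exists ((z * (1 + W)) ^+ s * W ^+ h.+2), ((z * (1 + W)) ^+ s * W ^+ h),
   ((z * (1 + W)) ^+ s * W ^+ h.+1); split.
- apply: (reduces_state (s, k.+1, h.+2)%N) => [|w] /=; first by lia.
  by rewrite gap_cons.
- by apply: (reduces_state (s, k, h)%N) => // w /=; rewrite gap_cons.
- by apply: (reduces_state (s, k.+1, h.+1)%N) => // w /=; rewrite gap_cons.
- rewrite /ind /= !exprS; set P := (z * _) ^+ s.
  apply: (eq_mod (- P * W ^+ h) (z * P * W ^+ h) 0).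
  ring.
Qed.

(** After [t] down steps another one must follow, which contributes [z], and [gf_mot_gap] with
    [s = 0] gives the rest; the letters before preserve the form [z * W ^+ h]. *)
Lemma gf_mot_gap2 t k h : (t <= k <= h)%N ->
  gf (fun w => ind [&& mot h.+1 w, gap t (marks Down w) == 1%N
                     & gap k.+1 (marks Down w) == 1%N])
  = z * W ^+ h.
Proof.
suff sol p : (p.1.1 <= p.1.2 <= p.2)%N ->
    gf (fun w => ind [&& mot p.2.+1 w, gap p.1.1 (marks Down w) == 1%N
                       & gap p.1.2.+1 (marks Down w) == 1%N])
    = z * W ^+ p.2 by exact: (sol (t, k, h)).
apply: (gf_solve_step (I := fun p => (p.1.1 <= p.1.2 <= p.2)%N)
  (F := fun p w => ind [&& mot p.2.+1 w, gap p.1.1 (marks Down w) == 1%N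
                       & gap p.1.2.+1 (marks Down w) == 1%N])
  (G := fun p => z * W ^+ p.2)) => {t k h p} [[[t k] h]] /=.
case: t => [|t] /andP[letk lekh].
  exists 0, ((z * (1 + W)) ^+ 0 * W ^+ h), 0; split.
  - apply: (reduces_dead (0, 0, 0)%N) => w.
    by rewrite gap0_false andbF.
  - apply: (reduces_known (0, 0, 0)%N); rewrite -(gf_mot_gap _ lekh).
    by apply: eq_gf => w _; rewrite gap_cons.
  - apply: (reduces_dead (0, 0, 0)%N) => w.
    by rewrite gap0_false andbF.
  - by rewrite /ind /=; ring.
case: k letk lekh => // k letk; case: h => // h lekh.
exists (z * W ^+ h.+2), (z * W ^+ h), (z * W ^+ h.+1); split.
- apply: (reduces_state (t.+1, k.+1, h.+2)%N) => [|w] /=; first by lia.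
  by rewrite !gap_cons.
- apply: (reduces_state (t, k, h)%N) => [|w] /=; first by lia.
  by rewrite !gap_cons.
- apply: (reduces_state (t.+1, k.+1, h.+1)%N) => [|w] /=; first by lia.
  by rewrite !gap_cons.
- rewrite /ind /= !exprS; apply: (eq_mod (- z * W ^+ h) (z ^+ 2 * W ^+ h) 0).
  ring.
Qed.

(** [W ^+ f y] stands for the paths that continue from the final height [y]: [f] is [id] if one of
    their gaps is prescribed and [predn] if two are, up to a factor [z]. *)
Definition wt (f : nat -> nat) (h : nat) (w : seq step) : A :=
  if run h w is Some y then W ^+ f y else 0.

(** Each number of down steps from 0 to [k] contributes [W ^+ h * M], as in [gf_downs] one level
    lower. *)
Lemma gf_few_downs k h : (k <= h)%N ->
  gf (fun w => ind (count_mem Down w <= k)%N * wt predn h.+1 w)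
  = k.+1%:R * W ^+ h * M.
Proof.
suff sol p : (p.1 <= p.2)%N ->
    gf (fun w => ind (count_mem Down w <= p.1)%N * wt predn p.2.+1 w)
    = p.1.+1%:R * W ^+ p.2 * M by exact: (sol (k, h)).
apply: (gf_solve_step (I := fun p => (p.1 <= p.2)%N)
  (F := fun p w => ind (count_mem Down w <= p.1)%N * wt predn p.2.+1 w)
  (G := fun p => p.1.+1%:R * W ^+ p.2 * M)) => {k h p} [[k h]] /=.
case: k => [|k] lekh.
  exists (1%:R * W ^+ h.+1 * M), 0, (1%:R * W ^+ h * M); split.
  - exact: (reduces_state (0, h.+1)%N).
  - by apply: (reduces_dead (0, 0)%N) => w; rewrite mul0r.
  - exact: (reduces_state (0, h)%N).
  - rewrite /ind /wt /= exprS.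
    apply: (eq_mod (- W ^+ h * (1 + W)) (W ^+ h) 0); ring.
case: h lekh => // h lekh.
exists (k.+2%:R * W ^+ h.+2 * M), (k.+1%:R * W ^+ h * M), (k.+2%:R * W ^+ h.+1 * M).
split.
- by apply: (reduces_state (k.+1, h.+2)%N) => //=; lia.
- exact: (reduces_state (k, h)%N).
- exact: (reduces_state (k.+1, h.+1)%N).
- rewrite /ind /wt /= !exprS -!natr1; set P := W ^+ h; set H := k%:R.
  apply: (eq_mod (- P * ((H + 2) * W ^+ 2 + (H + 2) * W + (H + 1)))
    ((H + 2) * P * W) 0).
  ring.
Qed.

(** Without down steps the letters up and flat are free, and [M] is the inverse of
    [1 - z * (1 + W)]. With [m <= h] the axis is never crossed, and the recurrence for [W ^+ h] does
    not see [m]. *)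
Lemma gf_downs m h : (m <= h)%N ->
  gf (fun w => ind (count_mem Down w == m) * wt id h w) = W ^+ h * M.
Proof.
suff sol p : (p.1 <= p.2)%N ->
    gf (fun w => ind (count_mem Down w == p.1) * wt id p.2 w) = W ^+ p.2 * M.
  by exact: (sol (m, h)).
apply: (gf_solve_step (I := fun p => (p.1 <= p.2)%N)
  (F := fun p w => ind (count_mem Down w == p.1) * wt id p.2 w)
  (G := fun p => W ^+ p.2 * M)) => {m h p} [[m h]] /=.
case: m => [|m] lemh.
  exists (W ^+ h.+1 * M), 0, (W ^+ h * M); split.
  - exact: (reduces_state (0, h.+1)%N).
  - by apply: (reduces_dead (0, 0)%N) => w; rewrite mul0r.
  - exact: (reduces_state (0, h)%N).
  - rewrite /ind /wt /= exprS.
    apply: (eq_mod (- W ^+ h * (1 + W)) (W ^+ h) 0); ring.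
case: h lemh => // h lemh.
exists (W ^+ h.+2 * M), (W ^+ h * M), (W ^+ h.+1 * M); split.
- by apply: (reduces_state (m.+1, h.+2)%N) => //=; lia.
- exact: (reduces_state (m, h)%N).
- exact: (reduces_state (m.+1, h.+1)%N).
- rewrite /ind /wt /= !exprS; set P := W ^+ h.
  apply: (eq_mod (- P * (W ^+ 2 + W + 1)) (P * W) 0); ring.
Qed.

Lemma gf_downs_gap k e h : (k + e <= h)%N ->
  gf (fun w => ind ((count_mem Down w == k + e)%N && (gap k (marks Down w) == 1%N))
               * wt id h w) = W ^+ h.
Proof.
suff sol p : (p.1 + e <= p.2)%N ->
    gf (fun w => ind ((count_mem Down w == p.1 + e)%N
               && (gap p.1 (marks Down w) == 1%N)) * wt id p.2 w) = W ^+ p.2.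
  by exact: (sol (k, h)).
apply: (gf_solve_step (I := fun p => (p.1 + e <= p.2)%N)
  (F := fun p w => ind ((count_mem Down w == p.1 + e)%N
               && (gap p.1 (marks Down w) == 1%N)) * wt id p.2 w)
  (G := fun p => W ^+ p.2)) => {k h p} [[k h]] /=.
case: k => [|k] lekh.
  (* The gap of length 1 is closed by the end of the word if [e = 0], and otherwise by a down step,
     followed by a word of [gf_downs]. *)
  exists 0, (if e is e'.+1 then W ^+ h.-1 * M else 0), 0; split.
  - apply: (reduces_dead (0, 0)%N) => w.
    by rewrite gap0_false andbF mul0r.
  - case: e lekh => [|e] lekh; first by apply: (reduces_dead (0, 0)%N) => w; rewrite mul0r.
    case: h lekh => // h lekh.
    apply: (reduces_known (0, 0)%N); rewrite /= -(@gf_downs e h) //; apply: eq_gf => w _.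
    by rewrite gap_cons /= andbT.
  - apply: (reduces_dead (0, 0)%N) => w.
    by rewrite gap0_false andbF mul0r.
  - case: e lekh => [|e]; rewrite /ind /wt /=; first by move=> _; ring.
    case: h => // h _ /=; rewrite exprS.
    apply: (eq_mod (- W ^+ h) 0 0); ring.
case: h lekh => // h lekh.
exists (W ^+ h.+2), (W ^+ h), (W ^+ h.+1); split.
- apply: (reduces_state (k.+1, h.+2)%N) => [|w] /=; first by lia.
  by rewrite gap_cons.
- apply: (reduces_state (k, h)%N) => // w /=; by rewrite gap_cons.
- by apply: (reduces_state (k.+1, h.+1)%N) => // w /=; rewrite gap_cons.
- rewrite addSn /ind /wt /= !exprS; set P := W ^+ h.
  apply: (eq_mod (- P) (z * P) 0); ring.
Qed.

Lemma gf_stepE (F : seq step -> A) :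
  gf F = F [::] + z * (gf (fun w => F (Up :: w)) + gf (fun w => F (Down :: w))
                       + gf (fun w => F (Flat :: w))).
Proof. by rewrite gf_cons // big_step. Qed.

Lemma gf_up_first h : (0 < h)%N ->
  gf (fun w => ind ((count_mem Down w == h) && (gap 0 (marks Up w) == 1%N))
               * wt id h w) = W ^+ h.+2.
Proof.
move=> h_gt0; rewrite gf_stepE.
have -> : gf (fun w => ind ((count_mem Down (Up :: w) == h)
    && (gap 0 (marks Up (Up :: w)) == 1%N)) * wt id h (Up :: w)) = W ^+ h.+1 * M.
  by rewrite -(@gf_downs h h.+1) //; apply: eq_gf => w _; rewrite gap_cons andbT.
rewrite [X in _ + X + _]gf_eq0 ?[X in _ + _ + X]gf_eq0 => [|w|w]; last first.
- by rewrite gap0_false andbF mul0r.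
- by rewrite gap0_false andbF mul0r.
case: h h_gt0 => // h _; rewrite /ind /= !exprS.
apply: (eq_mod (W ^+ 2 * W ^+ h) 0 0); ring.
Qed.

Lemma gf_up_first_gap k h : (0 < k <= h)%N ->
  gf (fun w => ind [&& count_mem Down w == h, gap k (marks Down w) == 1%N
                     & gap 0 (marks Up w) == 1%N] * wt id h w) = z * W ^+ h.+1.
Proof.
case/andP=> k_gt0 lekh; rewrite gf_stepE.
have -> : gf (fun w => ind [&& count_mem Down (Up :: w) == h,
    gap k (marks Down (Up :: w)) == 1%N & gap 0 (marks Up (Up :: w)) == 1%N]
    * wt id h (Up :: w)) = W ^+ h.+1.
  rewrite -(@gf_downs_gap k (h - k) h.+1); last by lia.
  apply: eq_gf => w _; rewrite subnKC // !gap_cons andbT.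
  by case: k k_gt0 {lekh}.
rewrite [X in _ + X + _]gf_eq0 ?[X in _ + _ + X]gf_eq0 => [|w|w]; last first.
- by rewrite gap0_false !andbF mul0r.
- by rewrite gap0_false !andbF mul0r.
have -> : (count_mem Down [::] == h) = false by apply/eqP => /=; lia.
by rewrite /ind /=; ring.
Qed.

(** After an up step the height is [h.+1]: either the prescribed gap between up steps opens right
    here, or the condition is the same one at the new height. *)
Lemma ind_gap_up c h b :
  ind ((h < c)%N && (gap (c - h) (true :: b) == 1%N)) =
  ind ((c == h.+1) && (gap 0 b == 1%N))
  + ind ((h.+1 < c)%N && (gap (c - h.+1) b == 1%N)).
Proof.
rewrite /ind gap_cons; have [->|neq_ch] := eqVneq c h.+1.
  by rewrite ltnSn subSnn subnn ltnn addr0.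
have -> : (h < c)%N = (h.+1 < c)%N by lia.
case: ltnP => [ltch|_] /=; rewrite add0r //.
by rewrite subnS; case: (c - h)%N (subn_gt0 h c) => [|m] //=; lia.
Qed.

(** The height alone is a sufficient state: a down step lowers both [count_mem Down w] and [h], and
    an up step lowers the index of the gap by raising [h]. *)
Lemma gf_late_up h :
  gf (fun w => ind ((h < count_mem Down w)%N
               && (gap (count_mem Down w - h) (marks Up w) == 1%N)) * wt id h w)
  = h.+1%:R * W ^+ h.+4 * E.
Proof.
apply: (gf_solve_step (I := fun=> True) (F := fun h w =>
    ind ((h < count_mem Down w)%N
         && (gap (count_mem Down w - h) (marks Up w) == 1%N)) * wt id h w)
  (G := fun h => h.+1%:R * W ^+ h.+4 * E)) => // {}h _.
exists (W ^+ h.+3 + h.+2%:R * W ^+ h.+1.+4 * E), (h%:R * W ^+ h.+3 * E),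
  (h.+1%:R * W ^+ h.+4 * E); split.
- apply: (reduces_add_state h.+1 (gf_up_first (ltn0Sn h))) => // w.
  by rewrite -mulrDl -ind_gap_up.
- case: h => [|h].
    by rewrite !mul0r; apply: (reduces_dead 0%N) => w; rewrite mulr0.
  apply: (reduces_state h) => // w /=; rewrite gap_cons add1n ltnS subSS.
  by congr (ind _ * _); case: ltnP => // lth; rewrite subn_eq0 leqNgt lth.
- apply: (reduces_state h) => // w /=; rewrite gap_cons add0n.
  by congr (ind _ * _); case: ltnP => // lth; rewrite subn_eq0 leqNgt lth.
rewrite /ind /wt mul0r !exprS -!natr1; set P := W ^+ h; set H := h%:R.
apply: (eq_mod (- (H + 1) * P * W ^+ 3 * E) (z * (H + 1) * P * W ^+ 3 * E)
  (z * P * W ^+ 3)).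
ring.
Qed.

(** At [k = 0] a down step must come next and leaves a word of [gf_late_up]. Until then, an up step
    either opens the gap between up steps, as in [gf_up_first_gap], or keeps the form of the
    condition. *)
Lemma gf_gap_late_up k h : (k <= h)%N ->
  gf (fun w => ind [&& (h < count_mem Down w)%N, gap k (marks Down w) == 1%N
                     & gap (count_mem Down w - h) (marks Up w) == 1%N] * wt id h w)
  = z * h%:R * W ^+ h.+3 * E.
Proof.
suff sol p : (p.1 <= p.2)%N ->
    gf (fun w => ind [&& (p.2 < count_mem Down w)%N, gap p.1 (marks Down w) == 1%N
                     & gap (count_mem Down w - p.2) (marks Up w) == 1%N] * wt id p.2 w)
    = z * p.2%:R * W ^+ p.2.+3 * E by exact: (sol (k, h)).
apply: (gf_solve_step (I := fun p => (p.1 <= p.2)%N) (F := fun p w =>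
    ind [&& (p.2 < count_mem Down w)%N, gap p.1 (marks Down w) == 1%N
          & gap (count_mem Down w - p.2) (marks Up w) == 1%N] * wt id p.2 w)
  (G := fun p => z * p.2%:R * W ^+ p.2.+3 * E)) => {k h p} [[k h]] /=.
case: k => [|k] lekh.
  exists 0, (h%:R * W ^+ h.+3 * E), 0; split.
  - by apply: (reduces_dead (0, 0)%N) => w; rewrite gap0_false andbF mul0r.
  - case: h {lekh} => [|h].
      by rewrite !mul0r; apply: (reduces_dead (0, 0)%N) => w; rewrite mulr0.
    apply: (reduces_known (0, 0)%N); rewrite -gf_late_up; apply: eq_gf => w _.
    rewrite !gap_cons /= add1n ltnS subSS.
    by congr (ind _ * _); case: ltnP => // lth; rewrite subn_eq0 leqNgt lth.
  - by apply: (reduces_dead (0, 0)%N) => w; rewrite gap0_false andbF mul0r.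
  - by rewrite /ind /=; ring.
case: h lekh => // h lekh.
exists (z * W ^+ h.+3 + z * h.+2%:R * W ^+ h.+1.+4 * E), (z * h%:R * W ^+ h.+3 * E),
  (z * h.+1%:R * W ^+ h.+4 * E); split.
- have lekh2 : (0 < k.+1 <= h.+2)%N by lia.
  apply: (reduces_add_state (k.+1, h.+2)%N (gf_up_first_gap lekh2)) => [|w] /=; first by lia.
  rewrite -mulrDl; congr (_ * _); rewrite !(andbCA _ (gap k.+1 _ == _)).
  rewrite gap_cons /=; case: (gap k.+1 _ == _) => /=; last by rewrite /ind addr0.
  exact: ind_gap_up.
- apply: (reduces_state (k, h)%N) => // w /=; rewrite !gap_cons add1n ltnS subSS.
  by congr (ind _ * _); case: ltnP => // lth; rewrite subn_eq0 leqNgt lth.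
- apply: (reduces_state (k.+1, h.+1)%N) => // w /=; rewrite !gap_cons !add0n.
  by congr (ind _ * _); case: ltnP => // lth; rewrite subn_eq0 leqNgt lth.
rewrite /ind /wt mul0r !exprS -!natr1; set P := W ^+ h; set H := h%:R.
apply: (eq_mod (- z * (H + 1) * P * W ^+ 3 * E) (z ^+ 2 * (H + 1) * P * W ^+ 3 * E)
  (z ^+ 2 * P * W ^+ 3)).
ring.
Qed.

(* The part between two double steps, the first of which is at height [h]: its [h]-th and
   [(h+1)]-st down steps are adjacent, and so are its [e]-th and [(e+1)]-st up steps, where [h + e]
   is the number of its down steps.  The lemmas from [gf_downs] on are the stages of its reading, in
   reverse order; [wt] records the final height. *)
Lemma gf_two_gaps h :
  gf (fun w => ind [&& (h <= count_mem Down w)%N, gap h (marks Down w) == 1%N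
                     & gap (count_mem Down w - h) (marks Up w) == 1%N] * wt id h w)
  = if h == 0 then 1 else z * W ^+ h.+1 + z * h%:R * W ^+ h.+3 * E.
Proof.
have split2 w : ind [&& (h <= count_mem Down w)%N, gap h (marks Down w) == 1%N
    & gap (count_mem Down w - h) (marks Up w) == 1%N] * wt id h w =
  ind [&& count_mem Down w == h, gap h (marks Down w) == 1%N
    & gap 0 (marks Up w) == 1%N] * wt id h w
  + ind [&& (h < count_mem Down w)%N, gap h (marks Down w) == 1%N
    & gap (count_mem Down w - h) (marks Up w) == 1%N] * wt id h w.
  rewrite -mulrDl; congr (_ * _); rewrite /ind leq_eqVlt eq_sym.
  case: eqP => [->|_] /=; last by rewrite add0r.
  by rewrite ltnn subnn addr0.
under eq_gf => w _ do rewrite split2.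
rewrite gfD gf_gap_late_up //; case: h {split2} => [|h]; last first.
  by rewrite gf_up_first_gap ?leqnn.
rewrite eqxx mulr0 !mul0r addr0 gf_stepE.
(* For [h = 0] only the empty word survives: a first up or flat step violates the gap between down
   steps, and a down step violates the count. *)
rewrite [X in X + _ + _]gf_eq0 ?[X in _ + X + _]gf_eq0 ?[X in _ + _ + X]gf_eq0.
- by rewrite /ind /wt /=; ring.
- by move=> w; rewrite gap0_false /= andbF mul0r.
- by move=> w; rewrite mul0r.
- by move=> w; rewrite gap0_false /= andbF mul0r.
Qed.

End ClosedForms.

Local Arguments eq_mod {A z W M E} _ _ _ c1 c2 c3 {a b} _.

(** * Two-coloured Motzkin paths *)

Lemma runs_ind (P : seq bool -> Prop) :
  (forall n, P (nseq n false)) ->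
  (forall n b, P b -> P (nseq n false ++ true :: b)) -> forall b, P b.
Proof.
move=> P0 P1 b; suff: forall n, P (nseq n false ++ b) by move=> /(_ 0).
elim: b => [|[] b IHb] n.
- by rewrite cats0; exact: P0.
- exact: P1 (IHb 0).
- by have := IHb n.+1; rewrite -[n.+1]addn1 nseqD -catA.
Qed.

(** Because of the additional occurrences at both ends, a mark is a clean cut: it closes the last
    gap on its left and opens the first on its right. *)
Lemma gaps_cat b1 b2 : gaps (b1 ++ true :: b2) = gaps b1 ++ gaps b2.
Proof.
elim: b1 => [|[] b1 IHb1] //=; rewrite IHb1 //.
by have := gap0_gt0 b1; rewrite /gap; case: (gaps b1).
Qed.

Lemma gaps_nseq n : gaps (nseq n false) = [:: n.+1].
Proof. by elim: n => //= n ->. Qed.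

Lemma size_gaps b : size (gaps b) = (count id b).+1.
Proof.
elim: b => [|[] b IHb] //=; first by rewrite IHb.
by rewrite size_behead IHb.
Qed.

Lemma gaps_rev b : gaps (rev b) = rev (gaps b).
Proof.
elim/runs_ind: b => [n|n b IHb]; first by rewrite rev_nseq gaps_nseq.
by rewrite rev_cat rev_cons cat_rcons !gaps_cat IHb rev_nseq rev_cat gaps_nseq.
Qed.

Lemma gap_rev k b : k <= count id b -> gap k (rev b) = gap (count id b - k) b.
Proof. by move=> lek; rewrite /gap gaps_rev nth_rev size_gaps ?ltnS ?subSS. Qed.

Lemma gap_gt0 k b : k <= count id b -> 0 < gap k b.
Proof.
move=> lek; suff: all (leq 1) (gaps b) by move/all_nthP; apply; rewrite size_gaps.
elim/runs_ind: b {lek} => [n|n b IHb]; first by rewrite gaps_nseq.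
by rewrite gaps_cat gaps_nseq.
Qed.

Lemma gap_cat k b1 b2 :
  gap k (b1 ++ true :: b2) =
  if k <= count id b1 then gap k b1 else gap (k - (count id b1).+1) b2.
Proof. by rewrite /gap gaps_cat nth_cat size_gaps ltnS. Qed.

Lemma count_marks x w : count id (marks x w) = count_mem x w.
Proof. by rewrite count_map. Qed.

Lemma step_eqE : ((Up == Down) = false) * ((Up == Flat) = false)
  * ((Down == Up) = false) * ((Down == Flat) = false)
  * ((Flat == Up) = false) * ((Flat == Down) = false).
Proof. by []. Qed.

Lemma count_mem_cons (T : eqType) (x y : T) w :
  count_mem x (y :: w) = (y == x) + count_mem x w.
Proof. by []. Qed.

Lemma run_count h w y :
  run h w = Some y -> y + count_mem Down w = h + count_mem Up w.
Proof.
elim: w h => [|x w IHw] h; first by case=> ->.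
rewrite !count_mem_cons; move: (count_mem Down w) (count_mem Up w) IHw => d u IHw.
case: x => /=; rewrite ?eqxx ?step_eqE.
- by move/IHw; lia.
- by case: h => // h /IHw; lia.
- by move/IHw; lia.
Qed.

Lemma run_cat h w1 w2 : run h (w1 ++ w2) = obind (run^~ w2) (run h w1).
Proof. by elim: w1 h => [|[] w1 IHw1] [|h] //=. Qed.

Definition mirror_step (x : step) : step :=
  match x with Up => Down | Down => Up | Flat => Flat end.

Definition mirror (w : seq step) : seq step := rev (map mirror_step w).

Lemma mirror_stepK : involutive mirror_step. Proof. by case. Qed.

Lemma mirrorK : involutive mirror.
Proof. by move=> w; rewrite /mirror map_rev revK mapK //; exact: mirror_stepK. Qed.

Lemma run_mirror h w y : run h w = Some y -> run y (mirror w) = Some h.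
Proof.
elim: w h => [|x w IHw] h; first by case=> ->.
rewrite /mirror /= rev_cons -cats1 run_cat => runw.
case: x runw => /=; first by move/IHw ->.
  by case: h => // h /IHw ->.
by move/IHw ->.
Qed.

Lemma mot_mirror h w : mot h (mirror w) = (run 0 w == Some h).
Proof.
apply/eqP/eqP => [/run_mirror|/run_mirror //]; by rewrite mirrorK.
Qed.

Lemma marks_mirror w : marks Down (mirror w) = rev (marks Up w).
Proof.
rewrite /marks /mirror map_rev -map_comp; congr rev; apply: eq_map.
by case.
Qed.

Local Notation letter := (bool * bool)%type.

Definition letter_of_step (x : step) : letter := (x == Down, x == Up).

Local Notation embed := (map letter_of_step).

(* The first bit of a letter marks a down step and the second one an up step, so that [(true, true)]
   is the double step. *)
Fixpoint mot4 (h : nat) (w : seq letter) : bool :=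
  match w with
  | [::] => h == 0
  | (true, false) :: w' => if h is h'.+1 then mot4 h' w' else false
  | (false, true) :: w' => mot4 h.+1 w'
  | _ :: w' => mot4 h w'
  end.

(* The contribution to [L] of a double step with prefix [u] and suffix [w]. *)
Definition factor (u w : seq letter) : nat :=
  let h := count snd u - count fst u in
  let r := gap h (rev (map snd u)) in
  'C(r + gap h (map fst w), r).

Fixpoint weight (u w : seq letter) : nat :=
  if w is c :: w' then
    (if c == (true, true) then factor u w' else 1) * weight (rcons u c) w'
  else 1.

Lemma mot4_embed h u w :
  mot4 h (embed u ++ w) = if run h u is Some h' then mot4 h' w else false.
Proof. by elim: u h => [|[] u IHu] [|h] /=. Qed.

Lemma weight_embed u v w : weight u (embed v ++ w) = weight (u ++ embed v) w.
Proof.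
elim: v u => [|x v IHv] u /=; first by rewrite cats0.
by rewrite IHv cat_rcons; case: x; rewrite mul1n.
Qed.

Lemma map_fst_embed w : map fst (embed w) = marks Down w.
Proof. by rewrite -map_comp. Qed.

Lemma map_snd_embed w : map snd (embed w) = marks Up w.
Proof. by rewrite -map_comp. Qed.

Lemma count_fst_embed w : count fst (embed w) = count_mem Down w.
Proof. by rewrite count_map. Qed.

Lemma count_snd_embed w : count snd (embed w) = count_mem Up w.
Proof. by rewrite count_map. Qed.

(** * Binomial coefficients equal to 2 or 4 *)

Lemma bin_ge_add r s : r + s + 2 <= 'C(r.+1 + s.+1, r.+1).
Proof.
elim: r => [|r IHr]; first by rewrite add1n bin1; lia.
rewrite [r.+2 + _]addSn binS.
have : 0 < 'C(r.+1 + s.+1, r.+2) by rewrite bin_gt0; lia.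
by lia.
Qed.

Lemma bin_ge_add2 r s : 6 <= 'C(r.+2 + s.+2, r.+2).
Proof.
rewrite [r.+2 + _]addSn binS.
have := bin_ge_add r s.+1; have := bin_ge_add r.+1 s.
by rewrite [r.+2 + _]addSnnS; lia.
Qed.

Lemma bin_ge2 r s : 0 < r -> 0 < s -> 2 <= 'C(r + s, r).
Proof. by case: r s => [|r] [|s] // _ _; apply: leq_trans (bin_ge_add _ _); lia. Qed.

Lemma bin_eq2 r s : ('C(r + s, r) == 2) = (r == 1) && (s == 1).
Proof.
case: r s => [|[|r]] s; first by rewrite bin0.
  by rewrite add1n bin1.
case: s => [|s]; first by rewrite addn0 binn.
by have := bin_ge_add r.+1 s; lia.
Qed.

(** On the border of Pascal's triangle the entries are 1, and at distance at least two from it they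
    are at least 6; so 4 occurs only next to the border, in the row 4. *)
Lemma bin_eq4 r s :
  ('C(r + s, r) == 4) = (r == 1) && (s == 3) || (r == 3) && (s == 1).
Proof.
case: r s => [|[|r]] s; first by rewrite bin0.
  by rewrite add1n bin1 orbF.
case: s => [|[|s]]; first by rewrite addn0 binn /= andbF.
  by rewrite addn1 binSn /= andbT.
by have := bin_ge_add2 r s; lia.
Qed.

Lemma mot4_count h w : mot4 h w -> h <= count fst w.
Proof.
elim: w h => [|[[] []] w IHw] h /=; first by move/eqP->.
- by move/IHw; lia.
- by case: h => // h /IHw.
- by move/IHw; lia.
- by move/IHw.
Qed.

Lemma mot4_embed_nil h v : mot4 h (embed v) = mot h v.
Proof.
rewrite -[embed v]cats0 mot4_embed /mot.
by case: (run h v) => [[]|].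
Qed.

Lemma factor_ge2 u w h :
  count snd u = count fst u + h -> mot4 h w -> 2 <= factor u w.
Proof.
move=> eq_h /mot4_count le_h; rewrite /factor eq_h addKn; apply: bin_ge2.
  by apply: gap_gt0; rewrite count_rev count_map eq_h leq_addl.
by apply: gap_gt0; rewrite count_map.
Qed.

(** Both gaps of a double step exist and are positive, so its factor is at least 2. This bounds the
    number of double steps of a path of weight 4. *)
Lemma weight_ge u w h :
  count snd u = count fst u + h -> mot4 h w ->
  2 ^ count_mem (true, true) w <= weight u w.
Proof.
elim: w u h => [|[a b] w IHw] u h eq_h //= mot_w.
have step h' : count snd (rcons u (a, b)) = count fst (rcons u (a, b)) + h' ->
    mot4 h' w -> 2 ^ (((a, b) == (true, true)) + count_mem (true, true) w) <=
    (if (a, b) == (true, true) then factor u w else 1) * weight (rcons u (a, b)) w.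
  move=> eq_h' mot_w'; rewrite expnD leq_mul ?(IHw _ h') //.
  case: eqP => // -[eqa eqb]; rewrite eqa eqb in eq_h' *.
  apply: factor_ge2 mot_w'; move: eq_h'; rewrite -!cats1 !count_cat /=; lia.
move: step; rewrite -!cats1 !count_cat eq_h /= => step.
case: a b mot_w step => [] [] /= mot_w step.
- by apply: (step h); first by lia.
- case: h eq_h mot_w step => // h eq_h mot_w step; by apply: (step h); first by lia.
- by apply: (step h.+1); first by lia.
- by apply: (step h); first by lia.
Qed.

Lemma factor_embed u v h : run 0 u = Some h ->
  let r := gap h (rev (marks Up u)) in
  factor (embed u) v = 'C(r + gap h (map fst v), r).
Proof.
move=> /run_count eq_h; rewrite /factor count_snd_embed count_fst_embed map_snd_embed.
by rewrite -[count_mem Up u]add0n -eq_h addnK.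
Qed.

Lemma mul_eq4 a b : 2 <= a -> 2 <= b -> (a * b == 4) = (a == 2) && (b == 2).
Proof.
move=> a2 b2; have [->|na] := eqVneq a 2; first by rewrite -[4]/(2 * 2) eqn_pmul2l.
have : 3 * 2 <= a * b by apply: leq_mul => //; lia.
by rewrite /=; lia.
Qed.

(** Two factors that are at least 2 have product 4 only if both are 2, that is, if all four gaps are
    1. The other double step counts as a down step in the suffix and as an up step in the prefix,
    whence the [true]. *)
Lemma weight_two_double u v w h h2 : run 0 u = Some h -> run h v = Some h2 -> mot h2 w ->
  (weight [::] (embed u ++ (true, true) :: embed v ++ (true, true) :: embed w) == 4)
  = [&& gap h (rev (marks Up u)) == 1,
        gap h (marks Down v ++ true :: marks Down w) == 1,
        gap h2 (rev (marks Up u ++ true :: marks Up v)) == 1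
      & gap h2 (marks Down w) == 1].
Proof.
move=> Eu Ev mot_w; have eq_h := run_count Eu; have eq_h2 := run_count Ev.
rewrite weight_embed /= weight_embed /= -[X in weight _ X]cats0 weight_embed /= muln1.
have bal1 : count snd (embed u) = count fst (embed u) + h.
  by rewrite count_snd_embed count_fst_embed; lia.
have bal2 : count snd (rcons (embed u) (true, true) ++ embed v)
    = count fst (rcons (embed u) (true, true) ++ embed v) + h2.
  rewrite !count_cat -!cats1 !count_cat bal1 count_snd_embed !count_fst_embed.
  by rewrite ![count _ [:: _]]/=; lia.
rewrite mul_eq4; first last.
- by apply: (factor_ge2 bal2); rewrite mot4_embed_nil.
- by apply: (factor_ge2 bal1); rewrite mot4_embed Ev /= mot4_embed_nil.
rewrite (factor_embed _ Eu) bin_eq2 map_cat /= !map_fst_embed.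
rewrite [factor _ (embed w)]/factor bal2 addKn.
by rewrite bin_eq2 map_cat map_rcons cat_rcons !map_snd_embed map_fst_embed -!andbA.
Qed.

(** * Summation over the double steps and their heights *)

Section Total.
Local Open Scope ring_scope.
Context (A : comNzRingType) (z : A) (K : nat) (zK : z ^+ K = 0).
Context (W M E : A) (zM : z * M = W) (ME : M = 1 + W + W ^+ 2) (EE : E = 1 + W ^+ 2 * E).
Context (EK : E = \sum_(h < K) W ^+ h.*2).

Local Notation gf := (gf z K).
Local Notation ind := (ind A).

(** A word without double step is the image of a path; any other word is cut at its first double
    step. *)
Lemma gf_letters (F : seq letter -> A) :
  gf F = gf (fun u => F (embed u))
         + z * gf (fun u => gf (fun w => F (embed u ++ (true, true) :: w))).
Proof.
(* The states are the weights [F] themselves: reading [x] replaces [F] by [fun w => F (x :: w)]. *)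
apply: (gf_solve zK (I := fun=> True) (F := id) (G := fun F : seq letter -> A =>
  gf (fun u => F (embed u))
  + z * gf (fun u => gf (fun w => F (embed u ++ (true, true) :: w))))) => // {}F _.
pose G (F : seq letter -> A) := gf (fun u => F (embed u))
  + z * gf (fun u => gf (fun w => F (embed u ++ (true, true) :: w))).
exists (fun x : letter => if x == (true, true) then gf (fun w => F (x :: w))
                          else G (fun w => F (x :: w))).
  move=> x; case: eqP => _.
    exact: (reduces_known (fun=> 0)).
  exact: (reduces_state (fun w => F (x :: w))).
rewrite [X in X + _ = _](gf_stepE zK) [X in _ + z * X = _](gf_stepE zK) /=.
rewrite [X in _ = _ + z * X](_ : _ = gf (fun w => F ((true, true) :: w))
  + G (fun w => F ((false, true) :: w)) + G (fun w => F ((true, false) :: w))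
  + G (fun w => F ((false, false) :: w))); last first.
  rewrite (bigD1 (true, true)) //= (bigD1 (false, true)) //= (bigD1 (true, false)) //=.
  rewrite (bigD1 (false, false)) //= big1 ?addr0 ?addrA //.
  by case=> [[] []].
by rewrite /G; ring.
Qed.

Lemma gf_by_height (c : seq step -> nat -> A) :
  gf (fun u => if run 0 u is Some h then c u h else 0)
  = \sum_(h < K) gf (fun u => ind (run 0 u == Some (val h)) * c u h).
Proof.
rewrite -(gf_sum _ _ _ (fun (h : 'I_K) u => ind (run 0 u == Some (val h)) * c u h)).
apply: eq_gf => u ltuK; case Eu: (run 0 u) => [h|].
  have lthK : (h < K)%N.
    apply: leq_ltn_trans ltuK; apply: leq_trans (count_size (pred1 Up) u).
    by rewrite -[count _ u]add0n -(run_count Eu) leq_addr.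
  rewrite (bigD1 (Ordinal lthK)) //= eqxx mul1r big1 ?addr0 // => i neq_ih.
  rewrite /ind; case: eqP => [[eq_hi]|_]; last by rewrite mul0r.
  by case/eqP: neq_ih; apply: val_inj.
by rewrite big1 // => h _; rewrite mul0r.
Qed.

Lemma gf_mirror (F : seq step -> A) : gf (fun w => F (mirror w)) = gf F.
Proof. exact: gf_map_rev mirror_stepK. Qed.

(** The mirror image turns a prefix that ends at height [h] into a suffix that starts there, and its
    up steps read backwards into down steps. *)
Lemma gf_run_gap s h :
  gf (fun u => ind ((run 0 u == Some h) && (gap h (rev (marks Up u)) == s.+1)))
  = (z * (1 + W)) ^+ s * W ^+ h.
Proof.
rewrite -(gf_mot_gap zK zM ME EE s (leqnn h)) -[RHS]gf_mirror.
by apply: eq_gf => u _; rewrite mot_mirror marks_mirror.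
Qed.

Lemma gf_run_gap2 t h : (t <= h)%N ->
  gf (fun u => ind [&& run 0 u == Some h.+1, gap t (rev (marks Up u)) == 1%N
                     & gap h.+1 (rev (marks Up u)) == 1%N]) = z * W ^+ h.
Proof.
move=> leth; rewrite -(gf_mot_gap2 zK zM ME EE (t := t) (k := h)) ?leth ?leqnn //.
rewrite -[RHS]gf_mirror.
by apply: eq_gf => u _; rewrite mot_mirror marks_mirror.
Qed.

Lemma W_nil j : (K <= j)%N -> W ^+ j = 0.
Proof.
by move=> leKj; rewrite -zM exprMn -(subnKC leKj) exprD zK !mul0r.
Qed.

(** The sum of [h x^h] is [x / (1 - x)^2], for [x = W ^+ 2]. *)
Lemma sum_hW : \sum_(h < K) h%:R * W ^+ h.*2 = W ^+ 2 * E ^+ 2.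
Proof.
have recur : \sum_(h < K) h%:R * W ^+ h.*2 =
    W ^+ 2 * E + W ^+ 2 * \sum_(h < K) h%:R * W ^+ h.*2.
  rewrite EK -mulrDr -big_split /=.
  case: K W_nil => [|k] Wk; first by rewrite !big_ord0 mulr0.
  rewrite big_ord_recl mul0r add0r [in RHS]big_ord_recr /=.
  rewrite mulrDr mulrDr [X in _ + (_ + X)]mulrCA -!exprD.
  rewrite ![in X in _ + X]Wk ?mulr0 ?addr0; last by lia.
  rewrite mulr_sumr; apply: eq_bigr => h _.
  by rewrite /bump add1n doubleS -natr1 !exprS; ring.
set S := \sum_(h < K) _ in recur *.
have E1 : E - W ^+ 2 * E = 1 by rewrite {1}EE addrK.
rewrite -[S]mulr1 -E1 mulrBr mulrCA mulrA -mulrBl {1}recur.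
by rewrite addrK [E ^+ 2]expr2 mulrA.
Qed.

(** At height [h] the side with gap 1 contributes [W ^+ h] and the side with gap 3 contributes
    [(z * (1 + W)) ^+ 2 * W ^+ h]; there are two choices of the sides, and the [W ^+ h.*2] add up to
    [E]. *)
Lemma gf_one_double :
  gf (fun u => gf (fun v =>
    let w := embed u ++ (true, true) :: embed v in
    ind (mot4 0 w && (weight [::] w == 4%N))))
  = 2%:R * (z * (1 + W)) ^+ 2 * E.
Proof.
pose c s s' u h : A := ind (gap h (rev (marks Up u)) == s.+1)
  * ((z * (1 + W)) ^+ s' * W ^+ h).
transitivity (gf (fun u => if run 0 u is Some h then c 0 2 u h + c 2 0 u h else 0)).
  apply: eq_gf => u _; case Eu: (run 0 u) => [h|]; last first.
    apply: gf_eq0 => v.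
    by rewrite /= mot4_embed Eu.
  rewrite /c -!(gf_mot_gap zK zM ME EE _ (leqnn h)) -!gfZ -gfD.
  apply: eq_gf => v _; rewrite /= mot4_embed Eu /= mot4_embed_nil weight_embed /=.
  rewrite (factor_embed _ Eu) map_fst_embed -[embed v]cats0 weight_embed muln1.
  rewrite bin_eq4 /ind; set r := gap _ _; set s := gap _ _.
  case: (mot h v); rewrite ?mulr0 ?addr0 //=.
  have [->|_] := eqVneq r 1%N; first by rewrite mul1r mul0r addr0 orbF.
  by rewrite mul0r add0r /=; case: (r == 3%N); rewrite ?mul1r ?mul0r.
rewrite gf_by_height EK mulr_sumr; apply: eq_bigr => h _.
transitivity (gf (fun u => (z * (1 + W)) ^+ 2 * W ^+ h *
    ind ((run 0 u == Some (val h)) && (gap h (rev (marks Up u)) == 1%N))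
  + W ^+ h *
    ind ((run 0 u == Some (val h)) && (gap h (rev (marks Up u)) == 3%N)))).
  apply: eq_gf => u _; rewrite /c /ind.
  by case: (run 0 u == _); rewrite /= ?mul0r ?mulr0 ?addr0 //; ring.
rewrite gfD !gfZ !gf_run_gap -addnn exprD; ring.
Qed.

(** If the middle part [v] has at least [h] down steps, both inner gaps lie in [v], and one
    prescribed gap is left for each of [u] and [w]. Otherwise the inner gap of the first double step
    lies in [w] and that of the second in [u], so that two gaps are prescribed on each side, as in
    [gf_mot_gap2]. *)
Lemma gf_outer_sum h v :
  gf (fun u => ind (run 0 u == Some h) * gf (fun w =>
    if run h v is Some h2 then
      ind [&& mot h2 w, gap h (rev (marks Up u)) == 1%N,
              gap h (marks Down v ++ true :: marks Down w) == 1%N,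
              gap h2 (rev (marks Up u ++ true :: marks Up v)) == 1%N
            & gap h2 (marks Down w) == 1%N]
    else 0))
  = (if h is k.+1 then z ^+ 2 * W ^+ k * (ind (count_mem Down v <= k)%N * wt W predn h v)
     else 0)
    + W ^+ h * (ind [&& (h <= count_mem Down v)%N, gap h (marks Down v) == 1%N
                 & gap (count_mem Down v - h) (marks Up v) == 1%N] * wt W id h v).
Proof.
case Ev: (run h v) => [h2|]; rewrite /wt Ev; last first.
  rewrite !mulr0 addr0 (_ : (if h is _.+1 then _ else _) = 0); last first.
    by case: h {Ev} => // k; rewrite !mulr0.
  apply: gf_eq0 => u.
  by rewrite gf0 mulr0.
set d := count_mem Down v; set p := count_mem Up v.
(* Hence [h2 <= p] exactly when [h <= d]: the two inner gaps leave [v] together. *)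
have bal : (h2 + d = h + p)%N by exact: run_count Ev.
have rev_gap u : rev (marks Up u ++ true :: marks Up v)
    = rev (marks Up v) ++ true :: rev (marks Up u).
  by rewrite rev_cat rev_cons cat_rcons.
have countp : count id (rev (marks Up v)) = p by rewrite count_rev count_marks.
have [le_hd|lt_dh] := leqP h d.
  rewrite (_ : (if h is _.+1 then _ else _) = 0) ?add0r; last first.
    case: h le_hd {Ev bal} => // k le_kd.
    by rewrite leqNgt le_kd /ind mul0r mulr0.
  set b := (gap h (marks Down v) == 1%N) && (gap (d - h) (marks Up v) == 1%N).
  transitivity (gf (fun u => ind b * W ^+ h2 *
      ind ((run 0 u == Some h) && (gap h (rev (marks Up u)) == 1%N)))).
    apply: eq_gf => u _.
    have -> : W ^+ h2 = (z * (1 + W)) ^+ 0 * W ^+ h2 by rewrite mul1r.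
    rewrite -(gf_mot_gap zK zM ME EE 0 (leqnn h2)) mulrAC -gfZ -gfZ.
    apply: eq_gf => w _.
    rewrite gap_cat count_marks -/d le_hd rev_gap gap_cat countp.
    have -> : (h2 <= p)%N by lia.
    rewrite [gap h2 (rev _)]gap_rev ?count_marks -/p; last by lia.
    have -> : (p - h2 = d - h)%N by lia.
    rewrite /b /ind -!natrM !mulnb; congr (nat_of_bool _)%:R.
    case: (run 0 u == _); case: (mot _ _); case: (gap h (marks _ _) == _) => //=;
    by rewrite ?andbF //= andbCA -!andbA; case: (gap h (rev _) == _); rewrite ?andbF.
  by rewrite gfZ gf_run_gap mul1r /=; ring.
rewrite /ind /= mul0r mulr0 addr0; case: h lt_dh bal Ev => // k lt_dk bal Ev.
case: h2 bal Ev => [|h2] bal Ev; first by lia.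
have le_dk : (d <= k)%N by [].
transitivity (gf (fun u => z * W ^+ h2 *
    ind [&& run 0 u == Some k.+1, gap (k - d) (rev (marks Up u)) == 1%N
          & gap k.+1 (rev (marks Up u)) == 1%N])).
  apply: eq_gf => u _.
  rewrite -(gf_mot_gap2 zK zM ME EE (t := (k - d)%N) (k := h2)); last by lia.
  rewrite [RHS]mulrC -gfZ -gfZ.
  apply: eq_gf => w _.
  rewrite gap_cat count_marks -/d ltnNge le_dk /= rev_gap gap_cat countp.
  have -> : (h2 < p)%N = false by lia.
  have -> : (h2.+1 - p.+1 = k - d)%N by lia.
  rewrite subSS /ind -!natrM !mulnb; congr (nat_of_bool _)%:R.
  case: (run 0 u == _) => //=; case: (mot _ _); rewrite ?andbF //=.
  by case: (gap (k - d) (rev _) == _); rewrite ?andbF //=.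
by rewrite gfZ gf_run_gap2 ?leq_subr // le_dk /=; ring.
Qed.

Lemma gf_two_double :
  gf (fun u => gf (fun v => gf (fun w =>
    let x := embed u ++ (true, true) :: embed v ++ (true, true) :: embed w in
    ind (mot4 0 x && (weight [::] x == 4%N)))))
  = 1 + z * W * (E ^+ 2 + E - 1 + W ^+ 4 * E ^+ 3).
Proof.
pose c u h := gf (fun v => gf (fun w =>
    if run h v is Some h2 then
      ind [&& mot h2 w, gap h (rev (marks Up u)) == 1%N,
              gap h (marks Down v ++ true :: marks Down w) == 1%N,
              gap h2 (rev (marks Up u ++ true :: marks Up v)) == 1%N
            & gap h2 (marks Down w) == 1%N]
    else 0)).
transitivity (gf (fun u => if run 0 u is Some h then c u h else 0)).
  apply: eq_gf => u _; case Eu: (run 0 u) => [h|]; last first.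
    apply: gf_eq0 => v.
    apply: gf_eq0 => w.
    by rewrite /= mot4_embed Eu.
  apply: eq_gf => v _; apply: eq_gf => w _.
  rewrite /= mot4_embed Eu /= mot4_embed; case Ev: (run h v) => [h2|] //=.
  rewrite mot4_embed_nil; case mot_w: (mot h2 w) => //=.
  by rewrite (weight_two_double Eu Ev mot_w).
rewrite gf_by_height.
pose e h : A := if h is k.+1 then
  h%:R * z * W ^+ k * W ^+ h + z * W ^+ h * W ^+ h.+1 + h%:R * z * W ^+ h * W ^+ h.+3 * E
  else 1.
transitivity (\sum_(h < K) e h).
  apply: eq_bigr => -[h ltK] _ /=.
  transitivity (gf (fun u => gf (fun v => ind (run 0 u == Some h) * gf (fun w =>
    if run h v is Some h2 then
      ind [&& mot h2 w, gap h (rev (marks Up u)) == 1%N,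
              gap h (marks Down v ++ true :: marks Down w) == 1%N,
              gap h2 (rev (marks Up u ++ true :: marks Up v)) == 1%N
            & gap h2 (marks Down w) == 1%N]
    else 0)))).
    by apply: eq_gf => u _; rewrite /c gfZ.
  (* The outer parts are summed first, for a fixed middle part. *)
  rewrite gf_exchange; under eq_gf => v _ do rewrite gf_outer_sum.
  rewrite gfD gfZ (gf_two_gaps zK zM ME EE); case: h {ltK} => [|k] /=.
    by rewrite gf0 add0r mul1r.
  rewrite gfZ (gf_few_downs zK zM ME EE) //.
  apply: (eq_mod zM ME EE (k.+1%:R * z * W ^+ k * W ^+ k) 0 0).
  rewrite !exprS; ring.
(* Chosen such that [e h.+1 = z * W * t h]. *)
pose t h : A := W ^+ h.*2 * (h.+1%:R * (1 + W ^+ 4 * E) + W ^+ 2).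
have sum_t : \sum_(h < K) t h = E ^+ 2 + E - 1 + W ^+ 4 * E ^+ 3.
  transitivity (\sum_(h < K) h%:R * W ^+ h.*2 * (1 + W ^+ 4 * E)
                + \sum_(h < K) W ^+ h.*2 * (1 + W ^+ 4 * E + W ^+ 2)).
    by rewrite -big_split; apply: eq_bigr => h _; rewrite /t -natr1 /=; ring.
  rewrite -!mulr_suml -EK sum_hW.
  apply: (eq_mod zM ME EE 0 0 (- (E + W ^+ 4 * E ^+ 2 + 1))); ring.
rewrite -sum_t.
have K_gt0 : (0 < K)%N.
  by rewrite lt0n; apply/eqP => K0; move/eqP: zK; rewrite K0 expr0 oner_eq0.
(* Height 0 gives the summand 1. After the shift of the index, the last term of the sum of [t] is
   left over; it contains [W] to the power [2 K - 1] and vanishes. *)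
rewrite -(prednK K_gt0) big_ord_recl big_ord_recr /= mulrDr.
have -> : z * W * t K.-1 = 0.
  rewrite /t !mulrA -[z * W * _]mulrA -exprS W_nil ?mulr0 ?mul0r //.
  by rewrite -addnn; lia.
rewrite addr0; congr (_ + _); rewrite mulr_sumr; apply: eq_bigr => h _.
rewrite /t -addnn /bump add0n add1n !exprS exprD; ring.
Qed.

Lemma gf_weight4 :
  gf (fun w => ind (mot4 0 w && (weight [::] w == 4%N)))
  = z * (2%:R * (z * (1 + W)) ^+ 2 * E)
    + z ^+ 2 * (1 + z * W * (E ^+ 2 + E - 1 + W ^+ 4 * E ^+ 3)).
Proof.
pose F w := ind (mot4 0 w && (weight [::] w == 4%N)).
rewrite gf_letters [X in X + _]gf_eq0 ?add0r; last first.
  by move=> u; rewrite -[embed u]cats0 weight_embed /= andbF.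
transitivity (z * (gf (fun u => gf (fun v => F (embed u ++ (true, true) :: embed v)))
  + z * gf (fun u => gf (fun v => gf (fun w =>
     F (embed u ++ (true, true) :: embed v ++ (true, true) :: embed w)))))).
  congr (_ * _); rewrite -gfZ -gfD; apply: eq_gf => u _.
  rewrite gf_letters; congr (_ + _ * _); apply: eq_gf => v _.
  rewrite gf_letters [X in _ + _ * X]gf_eq0 ?mulr0 ?addr0 //.
  move=> w; apply: gf_eq0 => x.
  rewrite /ind; case: (boolP (mot4 _ _)) => // mot_x; case: eqP => // weight_x.
  (* A third double step would make the weight at least 8. *)
  have := @weight_ge [::] _ 0 erefl mot_x; rewrite weight_x.
  rewrite !(count_cat, count_mem_cons) eqxx; set c1 := count _ _; set c2 := count _ _.
  set c3 := count _ _; set c4 := count _ _.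
  have : (2 ^ 3 <= 2 ^ (c1 + (true + (c2 + (true + (c3 + (true + c4)))))))%N.
    by rewrite leq_exp2l //=; lia.
  by move=> le1 le2; have := leq_trans le1 le2.
rewrite /F gf_one_double gf_two_double; ring.
Qed.

End Total.

(** * Dyck paths as two-coloured Motzkin paths *)

(* For each occurrence of [x] in [w], whether the next letter differs from [x]; [y] plays the letter
   after the end of [w]. *)
Fixpoint ends (x y : step) (w : seq step) : seq bool :=
  if w is c :: w' then
    if c == x then (head y w' != x) :: ends x y w' else ends x y w'
  else [::].

Lemma ends_cat x y w1 w2 : ends x y (w1 ++ w2) = ends x (head y w2) w1 ++ ends x y w2.
Proof.
elim: w1 => //= c w1 ->; case: eqP => // _; rewrite cat_cons; congr (_ :: _).
by case: w1.
Qed.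

Lemma size_ends x y w : size (ends x y w) = count_mem x w.
Proof. by elim: w => //= c w IHw; case: eqP => _ /=; rewrite IHw. Qed.

Lemma last_ends x y w : y != x -> last true (ends x y w).
Proof.
elim/last_ind: w y => // w c IHw y neq_yx; rewrite -cats1 ends_cat /=.
by case: eqP => [_|/eqP neq_cx]; rewrite ?last_cat ?cats0 //; exact: IHw.
Qed.

(* The two kinds of turns alternate along a path. *)
Lemma count_ends y w : y != Flat -> Flat \notin w ->
  count id (ends Up y w) + (head y w == Down) = count id (ends Down y w) + (y == Down).
Proof.
move=> y_flat; elim: w => [|c w IHw] //=.
rewrite inE negb_or => /andP[c_flat w_flat]; have {IHw} := IHw w_flat.
have : head y w != Flat.
  by case: w w_flat => //= d w; rewrite inE negb_or eq_sym => /andP[].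
case: c c_flat => // _; case: (head y w) => // _ /=; rewrite ?eqxx ?step_eqE /=; lia.
Qed.

Lemma split_occurrence (T : eqType) (x : T) w i : i < count_mem x w ->
  exists w1 w2, w = w1 ++ x :: w2 /\ count_mem x w1 = i.
Proof.
elim: w i => // c w IHw i; rewrite count_mem_cons.
have [->|neq_cx] := eqVneq c x; last first.
  by move=> /IHw[w1 [w2 [-> <-]]]; exists (c :: w1), w2; rewrite count_mem_cons (negbTE neq_cx).
case: i => [|i] lti; first by exists [::], w.
have /IHw[w1 [w2 [-> <-]]] : i < count_mem x w by [].
by exists (x :: w1), w2; rewrite count_mem_cons eqxx.
Qed.

Lemma nseq_of_notin (x y : step) w :
  count_mem x w = 0 -> (forall c, c \in w -> c = x \/ c = y) -> w = nseq (size w) y.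
Proof.
move=> /count_memPn x_notin sub; apply/all_pred1P/allP => c cw /=.
by case: (sub c cw) => [eqc|->//]; rewrite -eqc cw in x_notin.
Qed.

Lemma pos_cat x w1 w2 : pos x (w1 ++ x :: w2) (count_mem x w1).+1 = size w1.
Proof.
rewrite /pos size_cat iotaD filter_cat nth_cat /=.
set f := fun j => _.
have -> : size [seq j <- iota 0 (size w1) | f j] = count_mem x w1.
  rewrite size_filter -[in RHS](mkseq_nth Flat w1) /mkseq count_map.
  apply: eq_in_count => j; rewrite mem_iota /f => /andP[_ ltj] /=.
  by rewrite nth_cat ltj.
by rewrite ltnn subnn add0n /= /f nth_cat ltnn subnn /= eqxx.
Qed.

Lemma between_cat x w1 v w2 : count_mem x v = 0 ->
  between x (w1 ++ x :: v ++ x :: w2) (count_mem x w1).+1 = v.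
Proof.
move=> xv; rewrite /between pos_cat.
have := pos_cat x (w1 ++ x :: v) w2.
rewrite count_cat count_mem_cons eqxx xv addn1 -catA /= => ->.
rewrite -[w1 ++ x :: v ++ _]/(w1 ++ (x :: v) ++ x :: w2) catA take_size_cat //.
by rewrite -cat_rcons drop_size_cat // size_rcons.
Qed.

Lemma gap_cat_last b1 b2 : last true b1 -> gap (count id b1) (b1 ++ b2) = gap 0 b2.
Proof.
case/lastP: b1 => [|b1 c] //; rewrite last_rcons => ->.
by rewrite cat_rcons -cats1 count_cat /= addn1 gap_cat ltnn subnn.
Qed.

Lemma ends_nseq x y z n w : x != y -> head z w != x ->
  ends x z (nseq n.+1 x ++ w) = nseq n false ++ true :: ends x z w.
Proof.
move=> neq_xy neq_zx; elim: n => [|n IHn] /=; first by rewrite eqxx neq_zx.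
by move: IHn; rewrite /= !eqxx /= => ->.
Qed.

(** The bits of [ends y] are set at the last steps of the runs of [y], so the gaps are the lengths
    of these runs; the index is the number of earlier runs. *)
Lemma gap_between x y w1 r w2 : x != y -> x != Flat -> 0 < r ->
  gap (count id (ends y x w1)) (ends y Flat (w1 ++ x :: nseq r y ++ x :: w2)) = r.
Proof.
move=> neq_xy x_flat; case: r => // r _.
rewrite ends_cat gap_cat_last; last exact: last_ends.
have -> s : ends y Flat (x :: s) = ends y Flat s by rewrite /= (negbTE neq_xy).
rewrite (@ends_nseq _ x) //; last by rewrite eq_sym.
by rewrite gap_cat /gap gaps_nseq.
Qed.

(** * Recovering a Dyck path from the ends of its runs *)

Definition arrow (x : bool) : step := if x then Up else Down.

(** [x] is the direction of the current run, [a] holds the bits of that direction and [b] those of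
    the other. A set bit ends the run and exchanges the roles; [k] bounds the recursion. *)
Fixpoint weave (k : nat) (x : bool) (a b : seq bool) : seq step :=
  match k, a with
  | k'.+1, c :: a' => arrow x :: (if c then weave k' (~~ x) b a' else weave k' x a' b)
  | _, _ => [::]
  end.

Lemma weave_ends k x w : Flat \notin w -> size w <= k -> head (arrow x) w = arrow x ->
  weave k x (ends (arrow x) Flat w) (ends (arrow (~~ x)) Flat w) = w.
Proof.
elim: k x w => [|k IHk] x [|c w] //=; rewrite inE negb_or => /andP[_ w_flat] lek ->.
rewrite eqxx (_ : (arrow x == arrow (~~ x)) = false); last by case: x.
congr (_ :: _); case: eqP => /= [hw|hw].
  by apply: IHk => //; case: w hw {w_flat lek} => //=.
rewrite -[in ends (arrow x)](negbK x); apply: IHk => //.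
case: w hw w_flat {lek} => //= d w hd; rewrite inE negb_or => /andP[d_flat _].
by case: x d hd d_flat => [] [].
Qed.

(** Set bits count runs. The equation between the counts says that runs starting in direction [x]
    alternate and finish with a down run, so that neither list is exhausted early. *)
Lemma weaveP k x a b : size a + size b <= k -> last true a -> last true b ->
  count id a = count id b + ~~ x ->
  let w := weave k x a b in
  [/\ Flat \notin w, ends (arrow x) Flat w = a, ends (arrow (~~ x)) Flat w = b
    & head Flat w = if a is [::] then Flat else arrow x].
Proof.
have nil_b n b' : last true b' -> 0 = count id b' + n -> b' = [::].
  case/lastP: b' => // b' c; rewrite last_rcons => ->.
  by rewrite -cats1 count_cat /=; lia.
elim: k x a b => [|k IHk] x [|c a] b //=.
- by move=> _ _ last_b eq_b; rewrite (nil_b (~~ x) b).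
- by move=> _ _ last_b eq_b; rewrite (nil_b (~~ x) b).
move=> lek last_a last_b eq_ab.
have x_flat : arrow x != Flat by case: x {eq_ab}.
have x_arrow : (arrow (~~ x) == arrow x) = false by case: x {eq_ab x_flat}.
case: c last_a eq_ab => last_a eq_ab.
  have [||||] := IHk (~~ x) b a => //; first by lia.
    by rewrite negbK; case: x eq_ab {x_flat x_arrow} => /=; lia.
  rewrite negbK => w_flat ends_b ends_a head_w.
  rewrite !inE negb_or eq_sym x_flat w_flat eqxx (eq_sym (arrow x)) x_arrow ends_a ends_b.
  by split=> //; rewrite head_w; case: (b) => [|? ?]; rewrite ?(eq_sym Flat) ?x_arrow ?x_flat.
case: a last_a lek eq_ab => // c a last_a lek eq_ab.
have [||||w_flat ends_a ends_b head_w] := IHk x (c :: a) b => //.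
rewrite !inE negb_or eq_sym x_flat w_flat eqxx (eq_sym (arrow x)) x_arrow ends_a ends_b.
by split=> //; rewrite head_w eqxx.
Qed.

Lemma mot4P h w : reflect
  (h + count snd w = count fst w
   /\ forall i, count fst (take i w) <= h + count snd (take i w)) (mot4 h w).
Proof.
apply: (iffP idP).
  elim: w h => [|[[] []] w IHw] h /=; first by move/eqP->.
  - by case/IHw=> eqw lew; split=> [|[|i]] /=; [lia | | have := lew i; lia].
  - case: h => // h /IHw[eqw lew]; split=> [|[|i]] /=; [lia | | have := lew i; lia].
    by lia.
  - by case/IHw=> eqw lew; split=> [|[|i]] /=; [lia | | have := lew i; lia].
  - by case/IHw=> eqw lew; split=> [|[|i]] /=; [lia | | have := lew i; lia].
elim: w h => [|[[] []] w IHw] h /= [eqw lew]; first by rewrite addn0 in eqw; rewrite eqw.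
- by apply: IHw; split=> [|i]; [lia | have := lew i.+1; rewrite /=; lia].
- case: h eqw lew => [|h] eqw lew; first by have := lew 1; rewrite /= take0.
  by apply: IHw; split=> [|i]; [lia | have := lew i.+1; rewrite /=; lia].
- by apply: IHw; split=> [|i]; [lia | have := lew i.+1; rewrite /=; lia].
- by apply: IHw; split=> [|i]; [lia | have := lew i.+1; rewrite /=; lia].
Qed.

Lemma height_ge0 w : (0 <= height w)%R = (count_mem Down w <= count_mem Up w).
Proof. by rewrite /height Num.Theory.subr_ge0 ssrint.lez_nat. Qed.

Lemma dyck_pathP (p : seq step) : reflect
  [/\ Flat \notin p, count_mem Up p = count_mem Down p
    & forall w1 w2, p = w1 ++ w2 -> count_mem Down w1 <= count_mem Up w1]
  (dyck_path p).
Proof.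
rewrite /dyck_path /motzkin_path; apply: (iffP idP).
  case/andP=> [/andP[h0 /allP pre] p_flat]; split=> // [|w1 w2 eq_p].
    by move: h0; rewrite /height subr_eq0 => /eqP[].
  have := pre (size w1); rewrite mem_iota eq_p take_size_cat // size_cat height_ge0.
  by apply; rewrite add0n ltnS leq_addr leq0n.
case=> p_flat eq_ud pre; rewrite p_flat andbT.
have -> : height p == 0%R by rewrite /height eq_ud subrr.
by apply/allP => k _; rewrite height_ge0; apply: (pre _ (drop k p)); rewrite cat_take_drop.
Qed.

Lemma flat_cat w1 w2 : Flat \notin w1 ++ w2 -> Flat \notin w1 /\ Flat \notin w2.
Proof. by rewrite mem_cat negb_or => /andP. Qed.

Lemma dyck_head p : dyck_path p -> head Up p = Up.
Proof.
case/dyck_pathP; case: p => // [[] p] // p_flat _ pre.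
by have := pre [:: Down] p erefl.
Qed.

Lemma split_next (x y : step) p i : (forall c, c \in p -> c = x \/ c = y) ->
  i.+1 < count_mem x p -> exists w1 r w2,
    p = w1 ++ x :: nseq r y ++ x :: w2 /\ count_mem x w1 = i.
Proof.
move=> sub lti; have [w1 [w' [eq_p cnt_w1]]] := split_occurrence (ltnW lti).
have /split_occurrence[v [w2 [eq_w' cnt_v]]] : 0 < count_mem x w'.
  by move: lti; rewrite eq_p count_cat cnt_w1 count_mem_cons eqxx; lia.
exists w1, (size v), w2; split=> //.
rewrite eq_p eq_w'; congr (_ ++ _ :: _ ++ _).
apply: (nseq_of_notin cnt_v) => c cv; apply: sub.
by rewrite eq_p eq_w' mem_cat inE mem_cat cv !orbT.
Qed.

(** The part before the up step number [i + 1] starts with an up step and is followed by one, so it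
    has as many up runs as down runs by [count_ends]; and it contains at most [i] down steps. *)
Lemma dyck_ends_prefix p i : dyck_path p -> i < count_mem Up p ->
  count id (take i (ends Up Flat p)) <= count id (take i (ends Down Flat p)).
Proof.
move=> dyck_p; case: i => [|i] lti; first by rewrite !take0.
have /dyck_pathP[p_flat _ pre] := dyck_p.
have sub c : c \in p -> c = Up \/ c = Down.
  by case: c; [left | right | move=> cp; rewrite cp in p_flat].
have [w1 [r [w2 [eq_p cnt_w1]]]] := split_next sub lti.
set u := w1 ++ Up :: nseq r Down.
have eq_pu : p = u ++ Up :: w2 by rewrite eq_p -catA.
have [u_flat _] : Flat \notin u /\ Flat \notin Up :: w2 by apply: flat_cat; rewrite -eq_pu.
have cnt_up : count_mem Up u = i.+1.
  by rewrite count_cat count_mem_cons cnt_w1 count_nseq eqxx addn0 addn1.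
have -> : take i.+1 (ends Up Flat p) = ends Up Up u.
  by rewrite eq_pu ends_cat take_size_cat // size_ends.
have head_u : head Up u = Up.
  by have := dyck_head dyck_p; rewrite eq_p /u; case: (w1).
have := count_ends (y := Up) isT u_flat; rewrite head_u !addn0 => ->.
have -> : ends Down Up u = take (count_mem Down u) (ends Down Flat p).
  by rewrite eq_pu ends_cat take_size_cat // size_ends.
have := pre _ _ eq_pu; rewrite cnt_up => /subnKC <-.
by rewrite takeD count_cat leq_addr.
Qed.

(** A first violation is a down step from the axis. The prefix before it has equally many up and
    down steps, but one more ended up run than ended down runs, against the hypothesis. *)
Lemma ends_dyck p : Flat \notin p -> head Up p = Up ->
  (forall i, count id (take i (ends Up Flat p)) <= count id (take i (ends Down Flat p))) ->
  forall w1 w2, p = w1 ++ w2 -> count_mem Down w1 <= count_mem Up w1.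
Proof.
move=> p_flat head_p le_ends; elim/last_ind => [|w c IHw] w2 //.
rewrite cat_rcons -cats1 !count_cat => eq_p; have le_w := IHw _ eq_p.
case: c eq_p => eq_p; rewrite ?count_mem_cons; try by rewrite leq_add.
have [w_flat _] : Flat \notin w /\ Flat \notin Down :: w2 by apply: flat_cat; rewrite -eq_p.
have [lt_w|ge_w] := ltnP (count_mem Down w) (count_mem Up w).
  by rewrite eqxx step_eqE !addn0 addn1.
have := le_ends (count_mem Up w).
have eq_w : count_mem Up w = count_mem Down w by apply/eqP; rewrite eqn_leq ge_w.
rewrite {2}eq_w eq_p !ends_cat !take_size_cat ?size_ends //=.
have := count_ends (y := Down) isT w_flat.
have -> : head Down w = Up.
  by move: head_p; rewrite eq_p; case: (w).
by rewrite /= addn0 => ->; rewrite addn1 ltnn.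
Qed.

Lemma size_flatless p : Flat \notin p -> size p = count_mem Up p + count_mem Down p.
Proof.
elim: p => // c p IHp; rewrite inE negb_or !count_mem_cons /= => /andP[c_flat /IHp ->].
move: (count_mem Up p) (count_mem Down p) => u d.
by case: c c_flat => // _; rewrite !eqxx ?step_eqE; lia.
Qed.

Lemma dyck_count n p : dyck_path p -> size p = n.*2 ->
  count_mem Up p = n /\ count_mem Down p = n.
Proof. by case/dyck_pathP=> /size_flatless -> eq_ud _; rewrite -eq_ud; lia. Qed.

Lemma ends_rcons x n p : x != Flat -> count_mem x p = n.+1 ->
  ends x Flat p = rcons (take n (ends x Flat p)) true.
Proof.
move=> x_flat cnt; have /(_ x Flat p) := last_ends; rewrite eq_sym => /(_ x_flat).
have := size_ends x Flat p; rewrite cnt; case/lastP: (ends x Flat p) => // s c.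
by rewrite size_rcons last_rcons => -[<-] ->; congr rcons; rewrite -cats1 take_size_cat.
Qed.

Lemma dyck_ends_total p : dyck_path p ->
  count id (ends Up Flat p) = count id (ends Down Flat p).
Proof.
move=> dyck_p; have := dyck_head dyck_p; case/dyck_pathP: dyck_p.
case/lastP: p => // p c p_flat eq_ud pre head_p.
have le_p := pre p [:: c]; rewrite cats1 in le_p; have {pre}le_p := le_p erefl.
move: p_flat eq_ud head_p; rewrite -cats1 !count_cat => /flat_cat[p_flat c_flat].
case: c c_flat => // _ eq_ud head_p.
  by move: eq_ud; rewrite [count_mem Up [:: _]]/= [count_mem Down [:: _]]/=; lia.
have := count_ends (y := Down) isT p_flat.
have -> : head Down p = Up by case: (p) head_p.
by rewrite !ends_cat !count_cat /=; lia.
Qed.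

(** For semilength [n.+1] both lists have one more bit, which is always set by [ends_rcons] and is
    cut off. *)
Definition word n (p : seq step) : seq letter :=
  zip (take n (ends Up Flat p)) (take n (ends Down Flat p)).

Definition unword (w : seq letter) : seq step :=
  weave (size w).+1.*2 true (rcons (unzip1 w) true) (rcons (unzip2 w) true).

Section Word.
Context (n : nat) (p : seq step) (dyck_p : dyck_path p) (size_p : size p = n.+1.*2).

Lemma up_ends : ends Up Flat p = rcons (take n (ends Up Flat p)) true.
Proof. by apply: ends_rcons => //; have [] := dyck_count dyck_p size_p. Qed.

Lemma down_ends : ends Down Flat p = rcons (take n (ends Down Flat p)) true.
Proof. by apply: ends_rcons => //; have [] := dyck_count dyck_p size_p. Qed.

Lemma size_up_ends : size (take n (ends Up Flat p)) = n.
Proof.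
by rewrite size_takel // size_ends; have [-> _] := dyck_count dyck_p size_p.
Qed.

Lemma size_down_ends : size (take n (ends Down Flat p)) = n.
Proof.
by rewrite size_takel // size_ends; have [_ ->] := dyck_count dyck_p size_p.
Qed.

Lemma size_word : size (word n p) = n.
Proof. by rewrite size_zip size_up_ends size_down_ends minnn. Qed.

Lemma unzip1_word : unzip1 (word n p) = take n (ends Up Flat p).
Proof. by rewrite unzip1_zip // size_up_ends size_down_ends. Qed.

Lemma unzip2_word : unzip2 (word n p) = take n (ends Down Flat p).
Proof. by rewrite unzip2_zip // size_up_ends size_down_ends. Qed.

Lemma count_fst_take i : count fst (take i (word n p)) =
  count id (take (minn i n) (ends Up Flat p)).
Proof. by rewrite take_min -unzip1_word -map_take count_map. Qed.

Lemma count_snd_take i : count snd (take i (word n p)) =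
  count id (take (minn i n) (ends Down Flat p)).
Proof. by rewrite take_min -unzip2_word -map_take count_map. Qed.

Lemma mot4_word : mot4 0 (word n p).
Proof.
have [cntU _] := dyck_count dyck_p size_p.
apply/mot4P; split=> [|i].
  have := dyck_ends_total dyck_p; rewrite up_ends down_ends -!cats1 !count_cat.
  rewrite -unzip1_word -unzip2_word !count_map => /addIn; by rewrite add0n => <-.
rewrite count_fst_take count_snd_take; apply: dyck_ends_prefix => //.
by rewrite cntU ltnS geq_minr.
Qed.

Lemma unword_word : unword (word n p) = p.
Proof.
rewrite /unword size_word unzip1_word unzip2_word -up_ends -down_ends.
have /dyck_pathP[p_flat _ _] := dyck_p.
by apply: (@weave_ends _ true) => //; [rewrite size_p | exact: dyck_head].
Qed.

End Word.

Lemma unwordP w : mot4 0 w ->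
  [/\ dyck_path (unword w), size (unword w) = (size w).+1.*2
    & word (size w) (unword w) = w].
Proof.
case/mot4P=> eq_w le_w; rewrite /unword.
have sz1 : size (unzip1 w) = size w by rewrite size_map.
have sz2 : size (unzip2 w) = size w by rewrite size_map.
have cnt1 : count id (unzip1 w) = count fst w by rewrite count_map.
have cnt2 : count id (unzip2 w) = count snd w by rewrite count_map.
set k := _.*2; set a := rcons _ _; set b := rcons _ _.
have cnt_a : count id a = (count fst w).+1 by rewrite /a -cats1 count_cat cnt1 addn1.
have cnt_b : count id b = (count snd w).+1 by rewrite /b -cats1 count_cat cnt2 addn1.
have [||||] := @weaveP k true a b.
- by rewrite !size_rcons sz1 sz2 addnn.
- by rewrite last_rcons.
- by rewrite last_rcons.
- by rewrite cnt_a cnt_b -eq_w addn0.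
set p := weave k true a b => p_flat /= ends_a ends_b head_p.
have cntU : count_mem Up p = (size w).+1.
  by rewrite -(size_ends Up Flat) ends_a size_rcons sz1.
have cntD : count_mem Down p = (size w).+1.
  by rewrite -(size_ends Down Flat) ends_b size_rcons sz2.
split.
- apply/dyck_pathP; split=> //; first by rewrite cntU cntD.
  have {}head_p : head Flat p = Up by rewrite head_p /a; case: (unzip1 w).
  apply: ends_dyck => // [|i]; first by case: (p) head_p.
  rewrite ends_a ends_b /a /b -!cats1 !take_cat sz1 sz2.
  case: ltnP => [_|le_i]; last first.
    by rewrite !count_cat cnt1 cnt2 -eq_w.
  by have := le_w i; rewrite -!map_take !count_map.
- by rewrite size_flatless // cntU cntD addnn.
by rewrite /word ends_a ends_b /a /b -!cats1 !take_size_cat // zip_unzip.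
Qed.

(** * The statistic [L] as a weight *)

Lemma weightE u w : weight u w = \prod_(i < size w)
  (if nth (false, false) w i == (true, true)
   then factor (u ++ take i w) (drop i.+1 w) else 1).
Proof.
elim: w u => [|c w IHw] u /=; first by rewrite big_ord0.
rewrite big_ord_recl /= cats0 drop0; congr (_ * _).
by rewrite IHw; apply: eq_bigr => i _; rewrite cat_rcons.
Qed.

Lemma dyck_steps p : dyck_path p -> forall c, c \in p -> c = Up \/ c = Down.
Proof. by case/dyck_pathP=> p_flat _ _ [] cp; [left|right|rewrite cp in p_flat]. Qed.

Lemma rstatE p i : dyck_path p -> i.+1 < count_mem Up p ->
  rstat p i.+1 = if nth false (ends Up Flat p) i
                 then gap (count id (take i (ends Up Flat p))) (ends Down Flat p) else 0.
Proof.
move=> dyck_p lti; have sub := dyck_steps dyck_p.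
have [w1 [r [w2 [eq_p cnt_w1]]]] := split_next sub lti.
have -> : rstat p i.+1 = r.
  by rewrite /rstat eq_p -cnt_w1 between_cat ?count_nseq ?mul1n.
have /dyck_pathP[p_flat _ _] := dyck_p.
have w1_flat : Flat \notin w1 by move: p_flat; rewrite eq_p => /flat_cat[].
have head_w1 : head Up w1 = Up.
  by have := dyck_head dyck_p; rewrite eq_p; case: (w1).
have size_w1 : size (ends Up Up w1) = i by rewrite size_ends.
have eq_e : ends Up Flat p =
    ends Up Up w1 ++ ends Up Flat (Up :: nseq r Down ++ Up :: w2).
  by rewrite eq_p ends_cat.
rewrite eq_e take_size_cat // nth_cat size_w1 ltnn subnn.
case: r eq_p {eq_e} => [|r] eq_p //=.
have := count_ends (y := Up) isT w1_flat; rewrite head_w1 !addn0 => ->.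
by rewrite eq_p gap_between.
Qed.

(** Unlike in [rstatE], the current bit is counted: the path starts with an up run, so one more up
    run than down runs precedes the up run in question. *)
Lemma sstatE p i : dyck_path p -> i.+1 < count_mem Down p ->
  sstat p i.+1 = if nth false (ends Down Flat p) i
                 then gap (count id (take i.+1 (ends Down Flat p))) (ends Up Flat p) else 0.
Proof.
move=> dyck_p lti.
have sub c : c \in p -> c = Down \/ c = Up by move/(dyck_steps dyck_p); case; [right|left].
have [w1 [r [w2 [eq_p cnt_w1]]]] := split_next sub lti.
have -> : sstat p i.+1 = r.
  by rewrite /sstat eq_p -cnt_w1 between_cat ?count_nseq ?mul1n.
have /dyck_pathP[p_flat _ _] := dyck_p.
have w1_flat : Flat \notin w1 by move: p_flat; rewrite eq_p => /flat_cat[].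
have head_w1 : head Down w1 = Up.
  by have := dyck_head dyck_p; rewrite eq_p; case: (w1).
have size_w1 : size (ends Down Down w1) = i by rewrite size_ends.
have eq_e : ends Down Flat p =
    ends Down Down w1 ++ ends Down Flat (Down :: nseq r Up ++ Down :: w2).
  by rewrite eq_p ends_cat.
have lt_i : i < size (ends Down Flat p) by rewrite size_ends ltnW.
rewrite (take_nth false lt_i) eq_e take_size_cat // nth_cat size_w1 ltnn subnn.
case: r eq_p {eq_e} => [|r] eq_p //=.
rewrite -cats1 count_cat /=.
have := count_ends (y := Down) isT w1_flat; rewrite head_w1 /= !addn0 => <-.
by rewrite eq_p gap_between.
Qed.

(** An unset bit means [r_i = 0] or [s_i = 0], where the binomial is 1. At a double step with [ci]
    down and [cj] up steps before it, the height is [cj - ci], and the indices of the two runs are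
    counted from the double step instead of from the start of the path. *)
Lemma Lstat_word n p : dyck_path p -> size p = n.+1.*2 ->
  Lstat n.+1 p = weight [::] (word n p).
Proof.
move=> dyck_p size_p; have [cntU cntD] := dyck_count dyck_p size_p.
rewrite /Lstat big_add1 big_mkord weightE size_word //.
apply: eq_bigr => i _; have lt_in := ltn_ord i.
rewrite rstatE ?cntU ?ltnS // sstatE ?cntD ?ltnS //.
have := mot4_word dyck_p size_p; set w := word n p.
have w1E : map fst w = take n (ends Up Flat p) := unzip1_word dyck_p size_p.
have w2E : map snd w = take n (ends Down Flat p) := unzip2_word dyck_p size_p.
have nthE : nth (false, false) w i =
    (nth false (ends Up Flat p) i, nth false (ends Down Flat p) i).
  rewrite nth_zip ?size_up_ends ?size_down_ends // !nth_take //.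
move=> /mot4P[eq_w le_w].
have min_in : minn i n = i by apply/minn_idPl; exact: ltnW.
have map_take1 : map fst (take i w) = take i (ends Up Flat p).
  by rewrite map_take w1E -take_min min_in.
have map_take2 : map snd (take i w) = take i (ends Down Flat p).
  by rewrite map_take w2E -take_min min_in.
have split_w : w = take i w ++ nth (false, false) w i :: drop i.+1 w.
  by rewrite -drop_nth ?cat_take_drop // size_word.
rewrite nthE; case Ea : (nth _ (ends Up _ _) i); case Eb : (nth _ (ends Down _ _) i);
  rewrite ?addn0 ?add0n ?bin0 ?binn //=.
have size_b : i < size (ends Down Flat p) by rewrite size_ends cntD ltnW.
have size_a : i < size (ends Up Flat p) by rewrite size_ends cntU ltnW.
rewrite (take_nth false size_b) Eb -cats1 count_cat -map_take1 -map_take2 addn1.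
have cnt1 (s : seq letter) : count fst s = count id (map fst s) by rewrite count_map.
have cnt2 (s : seq letter) : count snd s = count id (map snd s) by rewrite count_map.
rewrite /factor !cnt1 !cnt2.
set ci := count id (map fst _); set cj := count id (map snd _).
have le_ij : ci <= cj by have := le_w i; rewrite add0n /ci /cj !count_map.
have drop_a : drop i.+1 (ends Up Flat p) = rcons (map fst (drop i.+1 w)) true.
  by rewrite (up_ends dyck_p size_p) drop_rcons ?size_up_ends // map_drop w1E.
(* So the gap lies within the suffix, where the virtual mark at the end replaces the bit cut off by
   [word]. *)
have bal : cj - ci <= count id (map fst (drop i.+1 w)).
  move: eq_w; rewrite {1 2}split_w nthE Ea Eb !count_cat /= !cnt1 !cnt2 -/ci -/cj; lia.
have -> : gap ci (ends Down Flat p) = gap (cj - ci) (rev (map snd (take i w))).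
  rewrite gap_rev ?leq_subr // subKn // map_take2.
  rewrite -[in LHS](cat_take_drop i (ends Down Flat p)) (drop_nth false size_b) Eb.
  by rewrite gap_cat -map_take2 le_ij.
have -> // : gap cj.+1 (ends Up Flat p) = gap (cj - ci) (map fst (drop i.+1 w)).
rewrite -[in LHS](cat_take_drop i (ends Up Flat p)) (drop_nth false size_a) Ea.
rewrite gap_cat -map_take1 -/ci ltnNge le_ij /= subSS drop_a.
by rewrite -cats1 gap_cat bal.
Qed.

Lemma card_in_bij (T U : finType) (A : {set T}) (B : {set U}) (f : T -> U) (g : U -> T) :
  {in A, forall x, f x \in B} -> {in B, forall y, g y \in A} ->
  {in A, cancel f g} -> {in B, cancel g f} -> #|A| = #|B|.
Proof.
move=> fAB gBA fK gK; rewrite -(card_in_imset (can_in_inj fK)); congr #|pred_of_set _|.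
apply/setP => y; apply/imsetP/idP => [[x Ax ->]|By]; first exact: fAB.
by exists (g y); [exact: gBA | rewrite gK].
Qed.

Lemma card_dyckL n k :
  #|dyckL n.+1 k| =
  #|[set w : n.-tuple letter | mot4 0 w && (weight [::] w == k)]|.
Proof.
(* The defaults of [insubd] in [f] and [g] are not reached on the two sets, since the lengths fit
   there. *)
pose f (p : n.+1.*2.-tuple step) : n.-tuple letter :=
  insubd [tuple of nseq n (false, false)] (word n p).
pose g (w : n.-tuple letter) : n.+1.*2.-tuple step :=
  insubd [tuple of nseq n.+1.*2 Flat] (unword w).
have fE p : dyck_path (tval p) -> val (f p) = word n p.
  by move=> dyck_p; rewrite val_insubd /= size_word ?size_tuple // eqxx.
have gE w : mot4 0 (tval w) -> val (g w) = unword w.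
  by case/unwordP=> _ size_w _; rewrite val_insubd /= size_w size_tuple eqxx.
apply: (card_in_bij (f := f) (g := g)) => [p|w|p|w]; rewrite !inE => /andP[].
- move=> dyck_p Lp; rewrite fE // mot4_word ?size_tuple //=.
  by rewrite -Lstat_word ?size_tuple.
- move=> mot_w Lw; have [dyck_w size_w wordK] := unwordP mot_w.
  rewrite gE // dyck_w (Lstat_word dyck_w) ?size_w ?size_tuple //=.
  by rewrite size_tuple in wordK; rewrite wordK.
- move=> dyck_p _; apply: val_inj.
  by rewrite gE fE ?mot4_word ?unword_word ?size_tuple.
- move=> mot_w _; have [dyck_w size_w wordK] := unwordP mot_w.
  apply: val_inj; rewrite fE gE //.
  by rewrite size_tuple in wordK.
Qed.

(** * Extraction of coefficients *)

Lemma gap0_index x w : gap 0 (marks x w) = (index x w).+1.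
Proof.
elim: w => //= y w IHw; rewrite gap_cons IHw.
by case: (y == x).
Qed.

Lemma motzkin_pathE p : motzkin_path p = mot 0 p.
Proof.
rewrite -mot4_embed_nil; apply/idP/mot4P.
  case/andP=> h0 /allP pre; rewrite count_fst_embed count_snd_embed; split=> [|i].
    by move: h0; rewrite /height subr_eq0 => /eqP[].
  rewrite -map_take count_fst_embed count_snd_embed add0n -height_ge0.
  have [le_i|lt_i] := leqP i (size p); first by apply: pre; rewrite mem_iota ltnS.
  by rewrite take_oversize 1?ltnW // -[p]take_size; apply: pre; rewrite mem_iota ltnS leqnn.
rewrite count_fst_embed count_snd_embed add0n => -[eq_ud le_p].
apply/andP; split; first by rewrite /height eq_ud subrr.
apply/allP => i _; rewrite height_ge0; have := le_p i.
by rewrite -map_take count_fst_embed count_snd_embed.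
Qed.

(** * Power series modulo a power of the variable *)

Section Algebraic.
Local Open Scope ring_scope.

Lemma motzkin_equation (A : comNzRingType) (z : A) K : z ^+ K = 0 ->
  exists W, W = z * (1 + W + W ^+ 2).
Proof.
move=> zK; pose f W := z * (1 + W + W ^+ 2).
(* [f] brings two arguments closer by one factor [z], so its iterates become stationary after [K]
   steps. *)
have step j : exists c, iter j.+1 f 0 - iter j f 0 = z ^+ j.+1 * c.
  elim: j => [|j [c eq_c]].
    exists 1; rewrite /= /f; ring.
  have fB a b : f b - f a = z * (b - a) * (1 + b + a) by rewrite /f; ring.
  exists (c * (1 + iter j.+1 f 0 + iter j f 0)).
  by rewrite [LHS]fB eq_c [z ^+ j.+2]exprS -!mulrA.
exists (iter K f 0); have [c] := step K; rewrite exprS zK mulr0 mul0r.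
by move/eqP; rewrite subr_eq0 => /eqP.
Qed.

Lemma geometric_inverse (A : comNzRingType) (W : A) K : W ^+ K = 0 ->
  let E := \sum_(h < K) W ^+ h.*2 in E = 1 + W ^+ 2 * E.
Proof.
move=> WK /=; case: K WK => [|k] WK.
  by move/eqP: WK; rewrite expr0 oner_eq0.
rewrite [LHS]big_ord_recl expr0 mulr_sumr [in RHS]big_ord_recr /=.
rewrite -exprD (_ : (2 + k.*2 = k.+1 + k.+1)%N) ?exprD ?WK ?mulr0 ?addr0; last by lia.
by congr (_ + _); apply: eq_bigr => h _; rewrite -exprD /bump; congr (_ ^+ _); lia.
Qed.

Section Quotient.
Context (m : nat).
Local Notation A := {poly %/ ('X^(m.+1) : {poly int})}.
Local Notation z := (in_qpoly 'X^(m.+1) 'X : A).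

Definition coef (i : nat) (a : A) : int := (a : {poly int})`_i.

Lemma coef_in_qpoly i (p : {poly int}) : (i <= m)%N ->
  coef i (in_qpoly 'X^(m.+1) p) = p`_i.
Proof.
move=> le_im; rewrite /coef /in_qpoly /= mk_monic_Xn.
rewrite [in RHS](Pdiv.RingMonic.rdivp_eq (monicXn _ m.+1) p) coefD coefMXn ltnS le_im.
by rewrite add0r.
Qed.

Lemma in_qpolyK (a : A) : in_qpoly 'X^(m.+1) a = a.
Proof. by apply: val_inj; exact: in_qpoly_small (size_mk_monic a). Qed.

Lemma qcoefM i a b : (i <= m)%N ->
  coef i (a * b) = \sum_(j < i.+1) coef j a * coef (i - j) b.
Proof.
move=> le_im; rewrite -(in_qpolyK a) -(in_qpolyK b) -in_qpolyM coef_in_qpoly // coefM.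
by apply: eq_bigr => j _; rewrite !in_qpolyK.
Qed.

Lemma zXn j : z ^+ j = in_qpoly 'X^(m.+1) 'X^j.
Proof. by rewrite -rmorphXn. Qed.

Lemma z_nil : z ^+ m.+1 = 0.
Proof.
by rewrite zXn; apply: val_inj => /=; rewrite mk_monic_Xn Pdiv.RingMonic.rmodpp ?monicXn.
Qed.

Lemma coefZn i j a : (i <= m)%N ->
  coef i (z ^+ j * a) = if (i < j)%N then 0 else coef (i - j) a.
Proof.
by move=> le_im; rewrite zXn -{1}(in_qpolyK a) -in_qpolyM coef_in_qpoly // coefXnM.
Qed.

Lemma qcoefD i a b : coef i (a + b) = coef i a + coef i b.
Proof. by rewrite /coef -coefD. Qed.

Lemma coef_sum i (I : Type) (r : seq I) (F : I -> A) :
  coef i (\sum_(j <- r) F j) = \sum_(j <- r) coef i (F j).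
Proof.
elim: r => [|j r IHr]; first by rewrite !big_nil /coef coef0.
by rewrite !big_cons qcoefD IHr.
Qed.

Lemma coef_nat i c : coef i (c%:R : A) = ((i == 0%N) * c)%:R.
Proof.
rewrite /coef qpolyC_natr -polyC_natr coefC.
by case: eqP => _; rewrite ?mul1n ?mul0n.
Qed.

Lemma coef_gf (T : finType) (f : seq T -> nat) i : (i <= m)%N ->
  coef i (gf z m.+1 (fun w => (f w)%:R)) = (\sum_(t : i.-tuple T) f t)%:R.
Proof.
move=> le_im; rewrite /gf coef_sum (bigD1 (Ordinal (le_im : (i < m.+1)%N))) //=.
rewrite coefZn // ltnn subnn /wsum -natr_sum coef_nat eqxx mul1n.
rewrite [X in _ + X]big1 ?addr0 // => j neq_ji; rewrite coefZn // -natr_sum coef_nat subn_eq0.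
case: ltngtP => // eq_ij.
by case/eqP: neq_ji; apply: val_inj.
Qed.

End Quotient.
End Algebraic.

Lemma card_tuples (T : finType) n (P : seq T -> bool) :
  #|[set t : n.-tuple T | P t]| = \sum_(t : n.-tuple T) P t.
Proof.
rewrite -sum1_card big_mkcond; apply: eq_bigr => t _.
by rewrite inE; case: (P t).
Qed.

(** * The number of Dyck paths as a coefficient *)

Definition motz (i : nat) : nat := \sum_(t : i.-tuple step) mot 0 t.

(** For [i = 2] the virtual mark after the end admits the path of two flat steps, in agreement with
    the convention for [T_{2,3}]. *)
Definition ball3 (i : nat) : nat :=
  \sum_(t : i.-tuple step) (mot 0 t && (gap 0 (marks Down t) == 3)).

Definition shift (j : nat) (f : nat -> nat) (i : nat) : nat :=
  if i < j then 0 else f (i - j).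

Definition conv (f g : nat -> nat) (i : nat) : nat := \sum_(j < i.+1) f j * g (i - j).

(** The semilength is [m.+1]. In [gf_weight4], [E = 1 + z ^+ 2 * M ^+ 2 * E] splits the part with
    one double step, and [W = z * M] turns the rest into [M], [M ^+ 3 * E ^+ 3] and the product of
    [M ^+ 2 * E] with [M]; [(z * (1 + W)) ^+ 2] is the series of [ball3]. *)
Lemma card_dyckL4 m : #|dyckL m.+1 4| =
  (m == 2) + 2 * shift 1 ball3 m + 2 * shift 3 (conv (fun i => i.+1 * motz i) ball3) m
  + shift 6 (fun i => 'C(i.+2, 2) * motz i) m + shift 4 motz m
  + 2 * shift 6 (conv (fun i => i.+1 * motz i) motz) m.
Proof.
pose A := {poly %/ ('X^(m.+1) : {poly int})}.
pose z : A := in_qpoly 'X^(m.+1) 'X.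
have zK : (z ^+ m.+1 = 0)%R := z_nil m.
have [W eq_W] := motzkin_equation zK.
pose M : A := (1 + W + W ^+ 2)%R.
have zM : (z * M = W)%R by rewrite -eq_W.
have WK : (W ^+ m.+1 = 0)%R by rewrite -zM exprMn zK mul0r.
pose E : A := (\sum_(h < m.+1) W ^+ h.*2)%R.
have EE : (E = 1 + W ^+ 2 * E)%R := geometric_inverse WK.
have total := gf_weight4 zK zM erefl EE erefl.
have gM : gf z m.+1 (fun w => (mot 0 w)%:R)%R = M.
  by rewrite [LHS](gf_mot zK zM erefl 0) expr0 mul1r.
have gT : gf z m.+1 (fun w => (mot 0 w && (gap 0 (marks Down w) == 3))%:R)%R
    = ((z * (1 + W)) ^+ 2)%R.
  by rewrite [LHS](gf_mot_gap zK zM erefl EE 2 (leqnn 0)) expr0 mulr1.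
have gN : gf z m.+1 (fun w => ((size w).+1 * mot 0 w)%:R)%R = (M ^+ 2 * E)%R.
  rewrite -[RHS]mul1r -[X in (X * _)%R](mul1r 1%R) mulrA.
  rewrite -(gf_mot_size zK zM erefl EE 0); apply: eq_gf => w _; exact: natrM.
have gB : gf z m.+1 (fun w => ('C((size w).+2, 2) * mot 0 w)%:R)%R = (M ^+ 3 * E ^+ 3)%R.
  transitivity (W ^+ 0 * M ^+ 3 * E ^+ 2 * ('C(1, 2)%:R + 1%:R * E))%R.
    by rewrite -(gf_mot_bin2 zK zM erefl EE 0); apply: eq_gf => w _; exact: natrM.
  by rewrite bin_small //; ring.
pose gm : A := gf z m.+1 (fun w => (mot 0 w)%:R)%R.
pose gt : A := gf z m.+1 (fun w => (mot 0 w && (gap 0 (marks Down w) == 3))%:R)%R.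
pose gn : A := gf z m.+1 (fun w : seq step => ((size w).+1 * mot 0 w)%:R)%R.
pose gb : A := gf z m.+1 (fun w : seq step => ('C((size w).+2, 2) * mot 0 w)%:R)%R.
have cm i : i <= m -> coef i gm = (motz i)%:R%R by move=> ?; exact: coef_gf.
have ct i : i <= m -> coef i gt = (ball3 i)%:R%R by move=> ?; exact: coef_gf.
have cn i : i <= m -> coef i gn = (i.+1 * motz i)%:R%R.
  move=> le_im; rewrite [LHS]coef_gf // big_distrr /=; congr (_%:R)%R.
  by apply: eq_bigr => t _; rewrite size_tuple.
have cb i : i <= m -> coef i gb = ('C(i.+2, 2) * motz i)%:R%R.
  move=> le_im; rewrite [LHS]coef_gf // big_distrr /=; congr (_%:R)%R.
  by apply: eq_bigr => t _; rewrite size_tuple.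
have cconv (f g : nat -> nat) (a b : A) i : i <= m ->
    (forall j, j <= m -> coef j a = (f j)%:R%R) ->
    (forall j, j <= m -> coef j b = (g j)%:R%R) -> coef i (a * b)%R = (conv f g i)%:R%R.
  move=> le_im ca cb'; rewrite qcoefM // /conv natr_sum; apply: eq_bigr => j _.
  have le_jm : j <= m by apply: leq_trans le_im; rewrite -ltnS.
  by rewrite ca // cb' ?natrM // (leq_trans (leq_subr _ _)).
have cshift (f : nat -> nat) (a : A) j : (forall i, i <= m -> coef i a = (f i)%:R%R) ->
    coef m (z ^+ j * a)%R = (shift j f m)%:R%R.
  by move=> ca; rewrite coefZn // /shift; case: ifP => // _; rewrite ca ?leq_subr.
apply/eqP; rewrite -(Num.Theory.eqr_nat int) card_dyckL
  (card_tuples _ (fun w => mot4 0 w && (weight [::] w == 4))); apply/eqP.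
transitivity (coef m (z ^+ 2 * 1%:R + (z ^+ 1 * gt + z ^+ 1 * gt)
    + (z ^+ 3 * (gn * gt) + z ^+ 3 * (gn * gt)) + z ^+ 6 * gb + z ^+ 4 * gm
    + (z ^+ 6 * (gn * gm) + z ^+ 6 * (gn * gm))))%R.
  rewrite -(coef_gf (fun w => mot4 0 w && (weight [::] w == 4)) (leqnn m)); congr coef.
  rewrite [LHS]total /gt /gn /gb /gm gT gN gB gM.
  apply: (eq_mod zM (erefl M) EE
    (- (2 * z ^+ 3 * (1 + W) ^+ 2 * E * (z * M + W) + z ^+ 3
        + z ^+ 3 * (E ^+ 3 + 2 * E) * (z ^+ 2 * M ^+ 2 + z * M * W + W ^+ 2)))
    0 (2 * z ^+ 3 * (1 + W) ^+ 2
       + z ^+ 3 * W * (2 + 2 * E - E ^+ 2 + E * (E - 1 - W ^+ 2 * E))))%R.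
  ring.
rewrite !qcoefD !(cshift _ _ _ ct) (cshift _ _ _ cb) (cshift _ _ _ cm).
rewrite !(cshift _ _ _ (fun i le_im => cconv _ _ _ _ i le_im cn ct)).
rewrite !(cshift _ _ _ (fun i le_im => cconv _ _ _ _ i le_im cn cm)).
rewrite (cshift (fun i => (i == 0) * 1) _ _ (fun i _ => coef_nat _ i 1)).
have -> : shift 2 (fun i => (i == 0) * 1) m = (m == 2).
  by rewrite /shift; case: ltngtP => // [|->] //; rewrite muln1; case: eqP => //; lia.
by rewrite !natrD !addr0.
Qed.

Lemma motzkinE i : motzkin i%:Z = motz i.
Proof.
rewrite /motzkin card_tuples; apply: eq_bigr => t _; by rewrite motzkin_pathE.
Qed.

Lemma motzkinB i j : motzkin (i%:Z - j%:Z)%R = shift j motz i.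
Proof.
rewrite /shift; case: ltnP => [lt_ij|le_ji].
  have -> : (i%:Z - j%:Z = Negz (j - i).-1)%R by lia.
  by [].
by rewrite -motzkinE; congr motzkin; lia.
Qed.

Lemma ball3_small k : k < 2 -> ball3 k = 0.
Proof.
move=> lt_k2; rewrite /ball3 big1 // => t _.
have := index_size Down t; rewrite size_tuple gap0_index => le_index.
have -> : ((index Down t).+1 == 3) = false by lia.
by rewrite andbF.
Qed.

Lemma ballotE k : 2 <= k -> ballot k 3 = ball3 k.
Proof.
move=> le_2k; rewrite /ballot eqSS; case: eqP => [->|_].
  rewrite /ball3 (bigD1 [tuple Flat; Flat]) //= big1 // => -[[|x [|y [|//]]] //= sz].
  by case: x y sz => [] [] sz // /eqP[]; apply: val_inj.
rewrite (card_tuples _ (fun t => motzkin_path t && ((index Down t).+1 == 3))).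
by apply: eq_bigr => t _; rewrite motzkin_pathE gap0_index.
Qed.

(** The last two terms involve [ball3 1] and [ball3 0], which vanish; hence the upper limit of the
    first sum in the theorem. *)
Lemma conv_ball3 f i : conv f ball3 i = \sum_(0 <= j < i.-1) f j * ball3 (i - j).
Proof.
rewrite /conv big_mkord; case: i => [|i].
  by rewrite big_ord_recr big_ord0 /= ball3_small // muln0.
rewrite !big_ord_recr /= subSnn subnn !ball3_small // !muln0 !addn0.
by apply: eq_bigr.
Qed.

Theorem theorem5p11 :
  (forall n : nat, 4 <= n ->
     #|dyckL n 4| =
       2 * (ballot (n - 2) 3
            + \sum_(0 <= i < n - 5)
                (i + 1) * motzkin i%:Z * ballot (n - 4 - i) 3)
       + 'C(n - 5, 2) * motzkin (n%:Z - 7%:Z)%R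
       + motzkin (n%:Z - 5%:Z)%R
       + 2 * \sum_(0 <= i < n - 6)
               (i + 1) * motzkin i%:Z * motzkin (n%:Z - 7%:Z - i%:Z)%R)
  /\ #|dyckL 3 4| = 1.
Proof.
split=> [[|m] // lt_3m|]; last first.
  (* For semilength 3, that is [m = 2], the isolated term is 1 and the only other candidate is
     [ball3 1 = 0]. *)
  by rewrite card_dyckL4 /shift /= ball3_small.
rewrite card_dyckL4 (_ : (m == 2) = false) ?add0n; last by lia.
rewrite mulnDr; congr (2 * _ + 2 * _ + _ + _ + 2 * _).
- rewrite /shift; case: ltnP => [|_]; first by lia.
  by rewrite ballotE ?subSS //; lia.
- rewrite /shift; case: ltnP => [|_]; first by lia.
  rewrite conv_ball3 (_ : (m - 3).-1 = m.+1 - 5); last by lia.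
  apply: eq_big_nat => i /andP[_ lt_i]; rewrite addn1 motzkinE ballotE; last by lia.
  by congr (_ * ball3 _); lia.
- rewrite motzkinB /shift (_ : (m.+1 < 7) = (m < 6)) //.
  case: ltnP => [|le_6m]; first by rewrite muln0.
  by congr ('C(_, 2) * motz _); lia.
- by rewrite motzkinB.
rewrite /shift; case: ltnP => [lt_m6|le_6m].
  by rewrite big_geq //; lia.
rewrite /conv big_mkord (_ : m.+1 - 6 = (m - 6).+1); last by lia.
apply: eq_bigr => i _; rewrite addn1 motzkinE; congr (_ * _).
rewrite -motzkinE; congr motzkin; have := ltn_ord i; lia.
Qed.
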